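(* Let $\mathcal{C}$ be an equivalence class of weighted forests and let $\mathcal{M}$ be the set of minimal elements of $\mathcal{C}$. Let $\mathcal{G}\in\mathcal{M}$, let $S$ be a skeleton and $\sigma:S\dashrightarrow\mathcal{G}$ a skeletal map (so $(\sigma,\mathcal{G})\in\mathrm{FO}^+(S)$), let $\mathcal{C}^+\subseteq\mathrm{FO}^+(S)$ be the equivalence class of $(\sigma,\mathcal{G})$, and let $\omega\in\Omega(S)$ be such that $\mathcal{C}^+\subseteq\mathrm{FO}^+(S,\omega)$. Let $\mathcal{M}^+\subseteq\mathcal{C}^+$ be the inverse image of $\min(\omega)$ under the map $\mathcal{C}^+\to\omega$, $(\sigma',\mathcal{G}')\mapsto W_{\mathcal{G}'}\circ\vec{\sigma'}$. Then $$\mathcal{M}=p_2(\mathcal{M}^+),$$ where $p_2(\sigma',\mathcal{G}')=\mathcal{G}'$.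
   Context: **Weighted graphs.** Graphs are finite, undirected, without loops or multiple edges; a weighted graph has an integer weight $w(v,\mathcal{G})$ at each vertex $v$; a forest is a graph without cycles. A blowing-up of a weighted graph $\mathcal G$ is any weighted graph isomorphic to one obtained by: (i) at a vertex $v$: add a new vertex $e$ of weight $-1$ and an edge $\{e,v\}$, and decrease the weight of $v$ by $1$; (ii) at an edge $\{v_1,v_2\}$ (subdivisional): delete this edge, add a new vertex $e$ of weight $-1$ and edges $\{v_1,e\},\{e,v_2\}$, and decrease the weights of $v_1,v_2$ by $1$; (iii) free: add an isolated vertex $e$ of weight $-1$. One chooses an identification of $\operatorname{Vtx}(\mathcal G)$ with the complement of $e$ in the vertex set of the blowing-up. Blowing-down (at $e$) is the inverse operation. A vertex $e$ is contractible if it has weight $-1$, has at most two neighbours, and any two distinct neighbours of $e$ are not adjacent; $\mathcal G$ is minimal if it has no contractible vertex. $\mathcal{G}\sim\mathcal{G}'$ (equivalent) means that one can be obtained from the other by finitely many blowings-up and blowings-down. A blowing-up of $\mathcal G$ is strict if it is subdivisional or is at a vertex $v$ with $\deg(v,\mathcal{G})\le 1$; its inverse is a strict blowing-down; strict equivalence is generated by strict blowings-up and strict blowings-down. **Sequences.** $\mathbb{Z}^*$ is the set of finite sequences of integers, including the empty one $\varnothing$; $X^-$ is the reversal of $X$. The blowings-up of a nonempty $X=(x_1,\dots,x_n)$ are $(-1,x_1-1,x_2,\dots,x_n)$, $(x_1,\dots,x_{i-1},x_i-1,-1,x_{i+1}-1,x_{i+2},\dots,x_n)$ for $1\le i<n$,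 and $(x_1,\dots,x_{n-1},x_n-1,-1)$; also $(-1)$ is the blowing-up of $\varnothing$. $\sim$ on $\mathbb{Z}^*$ is the equivalence relation generated. A sequence is minimal if no term equals $-1$. **Skeletal maps.** For a forest $G$ (weights, if any, are ignored), $P(G)$ is the set of nonempty sequences $\gamma=(v_0,\dots,v_n)$ of vertices such that either $n=0$ and $\deg(v_0)=0$; or $n>0$, the $v_i$ are distinct, consecutive ones are adjacent, and $\{i:\deg(v_i)\neq 2\}=\{0,n\}$. $\gamma$ is of type $(+,+)$ if $\deg v_0>2$ and $\deg v_n>2$; $\gamma^-$ is the reversed sequence. $\operatorname{Vtx}_{\ne2}(G)$ is the set of vertices of degree $\ne 2$. A skeletal map $f:G\dashrightarrow G'$ between forests is a map $f:\operatorname{Vtx}_{\neq2}(G)\to\operatorname{Vtx}_{\neq2}(G')$ such that: for each $\gamma=(v_0,\dots,v_m)\in P(G)$ there is a (necessarily unique) $\gamma'=(v'_0,\dots,v'_n)\in P(G')$ with $f(v_0)=v'_0$, $f(v_m)=v'_n$, and one writes $\vec f(\gamma)=\gamma'$; $\vec f:P(G)\to P(G')$ is surjective; and if $u\ne v$ and $f(u)=f(v)$ then some $(v_0,\dots,v_m)\in P(G)$ has $v_0=u$, $v_m=v$. A skeleton is a (non-weighted) forest with no vertex of degree $0$ or $2$. Every weighted forest admits a skeletal map from some skeleton. **Blowing-down map.** Let $\mathcal G'$ be a strict blowing-down of a weighted forest $\mathcal G$ at $e$. The skeletal map $\pi:\mathcal G\dashrightarrow\mathcal G'$ is the identity if $\deg(e,\mathcal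 G)=2$; if $\deg(e,\mathcal G)=1$, with neighbour $v$, then $\pi(e)=v$ and $\pi(x)=x$ for $x\in\operatorname{Vtx}_{\ne 2}(\mathcal G)\setminus\{e\}$. **Pseudo-minimal forests and $\mathrm{FO}^+(S)$.** For a weighted forest $\mathcal{G}$ and $\gamma=(v_0,\dots,v_n)\in P(\mathcal{G})$, $W_{\mathcal{G}}(\gamma)\in\mathbb{Z}^*$ is the sequence, in order, of the weights of those $v_i$ with $\deg(v_i,\mathcal G)<3$. $\mathcal G$ is pseudo-minimal if every $\gamma\in P(\mathcal G)$ with $W_{\mathcal G}(\gamma)\sim\varnothing$ is of type $(+,+)$ (equivalently, $\mathcal G$ is strictly equivalent to a minimal weighted forest). $\mathrm{FO}^+(S)$ is the set of pairs $(\sigma,\mathcal{G})$ with $\mathcal G$ a pseudo-minimal forest and $\sigma:S\dashrightarrow\mathcal{G}$ a skeletal map. In $\mathrm{FO}^+(S)$, $(\sigma',\mathcal{G}')$ is a blowing-down of $(\sigma,\mathcal{G})$ (and the latter a blowing-up of the former) if $\mathcal{G}'$ is a strict blowing-down of $\mathcal{G}$ and the blowing-down map $\pi$ satisfies $\pi\circ\sigma=\sigma'$; equivalence in $\mathrm{FO}^+(S)$ is generated by these operations. **Edge maps.** An edge map for $S$ is a map $W:P(S)\to\mathbb{Z}^*$ with $W(\gamma^-)=W(\gamma)^-$ for all $\gamma$, and such that $W(\gamma)\sim\varnothing$ implies $\gamma$ is of type $(+,+)$. Edge maps $W,W'$ are equivalent if $W(\gamma)\sim W'(\gamma)$ for all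 $\gamma$; $\Omega(S)$ is the set of equivalence classes. For $\omega\in\Omega(S)$, $\mathrm{FO}^+(S,\omega)$ is the set of $(\sigma,\mathcal{G})\in\mathrm{FO}^+(S)$ with $W_{\mathcal{G}}\circ\vec\sigma\in\omega$ (an equivalence class of $\mathrm{FO}^+(S)$ is always contained in one of these sets), and $\min(\omega)$ is the set of $W\in\omega$ such that $W(\gamma)$ is a minimal sequence for every $\gamma\in P(S)$. *)

(* Defs.v *)
From Stdlib Require Import Relations.
From mathcomp Require Import all_boot all_order all_algebra.

Set Implicit Arguments.
Unset Strict Implicit.
Unset Printing Implicit Defensive.

Import GRing.Theory.

Record graph := Graph {
  vtx :> finType;
  adj : rel vtx;
  adj_sym : symmetric adj;
  adj_irr : irreflexive adj }.

Record wgraph := WGraph {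
  gr :> graph;
  wt : gr -> int }.

Definition deg (G : graph) (v : G) : nat := #|[set u | adj v u]|.

Definition forest (G : graph) : Prop :=
  forall c : seq G, ucycle (@adj G) c -> size c <= 2.

(* The three kinds of blowing-up, recorded by the set A of vertices to which
   the new vertex gets joined. *)
Definition at_vertex (G : graph) (v : G) (A : {set G}) : Prop := A = [set v].
Definition at_edge (G : graph) (v1 v2 : G) (A : {set G}) : Prop :=
  adj v1 v2 /\ A = [set v1; v2].
Definition free (G : graph) (A : {set G}) : Prop := A = set0.

(* G1 is the blowing-up of G along A, with new vertex e; the injection i
   identifies Vtx(G) with the complement of e.  The edges of G inside A are
   deleted: there is exactly one when A is an edge and none when A has at most
   one element.  Stating this through i makes the notion closed under
   isomorphism. *)
Definition blowup_along (G G1 : wgraph) (A : {set G}) (e : G1) (i : G -> G1)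
    : Prop :=
  [/\ injective i /\ (forall x, (x != e) <-> (exists y, x = i y)),
      wt e = (-1)%R /\
        (forall x, wt (i x) = if x \in A then (wt x - 1)%R else wt x),
      forall x, adj e (i x) = (x \in A)
    & forall x y, adj (i x) (i y) = adj x y && ~~ ((x \in A) && (y \in A))].

Definition blowup (G G1 : wgraph) : Prop :=
  exists A e i, @blowup_along G G1 A e i /\
    [\/ exists v, at_vertex v A, exists v1 v2, at_edge v1 v2 A | free A].

Definition wequiv : wgraph -> wgraph -> Prop := clos_refl_sym_trans _ blowup.

Definition strict_blowup_at (G G1 : wgraph) (e : G1) (i : G -> G1) : Prop :=
  exists A, blowup_along A e i /\
    ((exists v1 v2, at_edge v1 v2 A) \/
     (exists v, at_vertex v A /\ deg v <= 1)).

Definition contractible (G : wgraph) (e : G) : Prop :=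
  [/\ wt e = (-1)%R, deg e <= 2
    & forall u v, adj e u -> adj e v -> u != v -> ~~ adj u v].

Definition minimal_graph (G : wgraph) : Prop := forall e : G, ~ contractible e.

Definition equiv_class_of_forests (C : wgraph -> Prop) : Prop :=
  exists F : wgraph, forest F /\ forall G, C G <-> wequiv F G.

Definition minimal_elements (C : wgraph -> Prop) (G : wgraph) : Prop :=
  C G /\ minimal_graph G.

Inductive seq_blowup : seq int -> seq int -> Prop :=
| SeqBlowupNil : seq_blowup [::] [:: -1]%R
| SeqBlowupLeft x X : seq_blowup (x :: X) [:: -1, x - 1 & X]%R
| SeqBlowupMid X x y Y :
    seq_blowup (X ++ [:: x, y & Y]) (X ++ [:: x - 1, -1, y - 1 & Y])%R
| SeqBlowupRight X x : seq_blowup (X ++ [:: x]) (X ++ [:: x - 1; -1])%R.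

Definition seq_equiv : seq int -> seq int -> Prop :=
  clos_refl_sym_trans _ seq_blowup.

Definition minimal_seq (X : seq int) : Prop := (-1)%R \notin X.

(* Vtx_{<> 2}(G) *)
Definition core (G : graph) := {v : G | deg v != 2}.

(* A nonempty sequence (v_0, ..., v_n) is encoded as (v_0, [:: v_1; ...; v_n]). *)
Definition is_epath (G : graph) (g : G * seq G) : bool :=
  let: (v, p) := g in
  if p is [::] then deg v == 0 else
  [&& uniq (v :: p), path (@adj G) v p
    & [forall i : 'I_(size p).+1,
        (deg (nth v (v :: p) i) != 2) ==
        ((i == 0 :> nat) || (i == size p :> nat))]].

(* P(G) *)
Definition epath (G : graph) := {g : G * seq G | is_epath g}.

Definition pseq (G : graph) (g : epath G) : seq G := (val g).1 :: (val g).2.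

Fact src_subproof (G : graph) (g : epath G) : deg (val g).1 != 2.
Proof.
case: g => [[v [|w p]]] /=; first by move/eqP->.
by case/and3P=> _ _ /forallP /(_ ord0) /=; rewrite eqb_id.
Qed.

Fact tgt_subproof (G : graph) (g : epath G) :
  deg (last (val g).1 (val g).2) != 2.
Proof.
case: g => [[v [|w p]]] /=; first by move/eqP->.
case/and3P=> _ _ /forallP /(_ ord_max) /=; rewrite eqxx eqb_id.
by rewrite (nth_last v (w :: p)).
Qed.

Definition src (G : graph) (g : epath G) : core G :=
  exist _ (val g).1 (src_subproof g).

Definition tgt (G : graph) (g : epath G) : core G :=
  exist _ (last (val g).1 (val g).2) (tgt_subproof g).

Fact rev_epath_subproof (G : graph) (g : epath G) :
  is_epath (last (val g).1 (val g).2, rev (belast (val g).1 (val g).2)).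
Proof.
case: g => [[v p]] /= H.
have E : last v p :: rev (belast v p) = rev (v :: p).
  by rewrite [in RHS]lastI rev_rcons.
case: p H E => [|w p] H E; first exact: H.
case/and3P: H => Hu Hpath /forallP Hf.
have Hs : size (rev (belast v (w :: p))) = (size p).+1.
  by rewrite size_rev size_belast.
have Hp : path (@adj G) (last v (w :: p)) (rev (belast v (w :: p))).
  rewrite rev_path; apply: sub_path Hpath => x y; by rewrite adj_sym.
case: (rev _) Hs E Hp => [//|a q] Hs E Hp.
apply/and3P; split; [|exact: Hp|apply/forallP=> i].
  by rewrite -[_ && _]/(uniq [:: last v (w :: p), a & q]) E rev_uniq.
rewrite E; case: i => i /=; rewrite ltnS; move: Hs => /= -> Hi.
rewrite nth_rev; last by rewrite /= ltnS.
have Hk : size (v :: w :: p) - i.+1 < (size (w :: p)).+1.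
  by rewrite /= subSS ltnS leq_subr.
move: (Hf (Ordinal Hk)) => /=.
rewrite (set_nth_default v) //= => /eqP ->; rewrite subSS.
case: i Hi Hk => [|k] Hi _; first by rewrite subn0 eqxx orbT.
rewrite ltnS in Hi.
have E1 : (size p - k == (size p).+1) = false.
  by apply/negbTE; rewrite neq_ltn ltnS leq_subr.
by rewrite subSS eqSS E1 orbF subn_eq0 [k == _]eqn_leq Hi.
Qed.

Definition rev_epath (G : graph) (g : epath G) : epath G :=
  exist _ (last (val g).1 (val g).2, rev (belast (val g).1 (val g).2))
    (rev_epath_subproof g).

Fact pseq_rev_epath (G : graph) (g : epath G) :
  pseq (rev_epath g) = rev (pseq g).
Proof. by rewrite /pseq /= [in RHS]lastI rev_rcons. Qed.

Definition type_pp (G : graph) (g : epath G) : Prop :=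
  2 < deg (val (src g)) /\ 2 < deg (val (tgt g)).

Definition ends_match (G G' : graph) (f : core G -> core G')
    (g : epath G) (g' : epath G') : bool :=
  (f (src g) == src g') && (f (tgt g) == tgt g').

(* The map on paths induced by f; between forests the chosen path is the only
   one with the prescribed ends. *)
Definition vec (G G' : graph) (f : core G -> core G')
    (h : forall g, exists g', ends_match f g g') (g : epath G) : epath G' :=
  xchoose (h g).

Record skelmap (G G' : graph) := SkelMap {
  sfun :> core G -> core G';
  sk_path : forall g, exists g', ends_match sfun g g';
  sk_surj : forall g', exists g, vec sk_path g = g';
  sk_inj : forall u v, u != v -> sfun u = sfun v ->
    exists g, src g = u /\ tgt g = v }.

Definition svec (G G' : graph) (f : skelmap G G') : epath G -> epath G' :=
  vec (sk_path f).

Definition skeleton (S : graph) : Prop :=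
  forest S /\ forall v : S, deg v <> 0 /\ deg v <> 2.

Definition Wt (G : wgraph) (g : epath G) : seq int :=
  [seq wt v | v <- pseq g & deg v < 3].

Definition pseudo_minimal (G : wgraph) : Prop :=
  forest G /\ forall g : epath G, seq_equiv (Wt g) [::] -> type_pp g.

Record skpair (S : graph) := SkPair {
  p2 : wgraph;
  skmap : skelmap S p2 }.

Definition FOplus (S : graph) (q : skpair S) : Prop := pseudo_minimal (p2 q).

(* pi is the blowing-down map G --> G' at e, the vertices of G' being
   identified with those of G other than e by i.  The vertex e belongs to
   core G only if deg e = 1, and then it is sent to its unique neighbour. *)
Definition is_blowdown_map (G G' : wgraph) (e : G) (i : G' -> G)
    (pi : core G -> core G') : Prop :=
  forall x : core G,
    (val x = e -> adj e (i (val (pi x)))) /\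
    (val x <> e -> i (val (pi x)) = val x).

Definition FO_blowdown (S : graph) (q q' : skpair S) : Prop :=
  exists (e : p2 q) (i : p2 q' -> p2 q) (pi : core (p2 q) -> core (p2 q')),
    [/\ strict_blowup_at e i, is_blowdown_map e i pi
      & forall s, pi (skmap q s) = skmap q' s].

Definition FO_iso (S : graph) (q q' : skpair S) : Prop :=
  exists phi : p2 q -> p2 q',
    [/\ bijective phi, forall x y, adj (phi x) (phi y) = adj x y,
        forall x, wt (phi x) = wt x
      & forall s, phi (val (skmap q s)) = val (skmap q' s)].

(* Equivalence in FO^+(S).  Isomorphic pairs with p2 q nonempty are always
   related by a strict blowing-up followed by a strict blowing-down, so FO_iso
   matters for the empty forest only: it admits no strict blowing-up, and,
   vertices forming a type, it has several copies that must be identified. *)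
Definition FO_equiv (S : graph) : skpair S -> skpair S -> Prop :=
  clos_refl_sym_trans _ (fun q q' =>
    [/\ FOplus q, FOplus q' & FO_blowdown q q' \/ FO_iso q q']).

Definition FO_class (S : graph) (q q' : skpair S) : Prop :=
  FOplus q' /\ FO_equiv q q'.

Definition edge_map (S : graph) (W : epath S -> seq int) : Prop :=
  (forall g, W (rev_epath g) = rev (W g)) /\
  (forall g, seq_equiv (W g) [::] -> type_pp g).

(* omega is an element of Omega(S). *)
Definition is_Omega (S : graph) (omega : (epath S -> seq int) -> Prop) : Prop :=
  exists W0, edge_map W0 /\
    forall W, omega W <-> edge_map W /\ forall g, seq_equiv (W0 g) (W g).

Definition min_omega (S : graph) (omega : (epath S -> seq int) -> Prop)
    (W : epath S -> seq int) : Prop :=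
  omega W /\ forall g, minimal_seq (W g).

(* W_{G'} o vec sigma', for q = (sigma', G') *)
Definition pair_edge_map (S : graph) (q : skpair S) : epath S -> seq int :=
  fun g => Wt (svec (skmap q) g).

Definition FOplus_omega (S : graph) (omega : (epath S -> seq int) -> Prop)
    (q : skpair S) : Prop :=
  FOplus q /\ omega (pair_edge_map q).

(* Main.v *)
From Stdlib Require Import Relations.
Require Import Defs.
From mathcomp Require Import all_boot all_order all_algebra.

Set Implicit Arguments.
Unset Strict Implicit.
Unset Printing Implicit Defensive.

Import Order.TTheory GRing.Theory Num.Theory.

(** The theorem rests on one fact: two equivalent minimal weighted forests are strictly
    equivalent ([minimal_wequiv_strict_equiv]).  A strict equivalence can then be followed
    in FO^+(S), because the blowing-down map of a strict blowing-down is skeletal and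
    preserves the class of the weight sequence along every path.

    Strictness.  It suffices that all minimal forests to which a given forest F contracts
    are strictly equivalent ([forest_confluent]), for along a chain of blowings-up and
    blowings-down the set of these minimal forests then stays in one strict class.  The
    proof is by induction on the number of vertices of F.  Contractions at two
    nonadjacent contractible vertices commute, so the induction hypothesis applies.
    Let e and e' be adjacent and contractible.  If some contractible vertex is adjacent to neither,
    it serves as an intermediary.  Otherwise, in the contraction of F at e, the vertex e'
    has weight 0 and degree at most 2, and every contractible vertex is adjacent to
    it.  This situation persists under further contractions, and all of them are strict
    ([reduces_strictly]); thus F itself is strictly equivalent to a minimal forest obtained
    through e, and likewise to one obtained through e'.

    Skeletal maps.  If F is a strict blowing-up of G, removing the new vertex from a path
    of F gives a path of G, and the weight sequence undergoes at most one blowing-down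
    ([epath_down]); conversely every path of G arises in this way ([epath_up]).  Hence the
    blowing-down map from F to G is skeletal, and F is pseudo-minimal exactly when G is.  A
    skeletal map to F is pushed to G by composition ([skelmap_comp]); a skeletal map from a
    skeleton to G lifts to F ([skelmap_lift]), since the fibres of a skeletal map have at
    most two elements, and two only above an isolated vertex.

    Minimality.  A nonempty sequence without the term -1 is not equivalent to the empty
    one ([minimal_seq_equiv_nil]), so minimal forests are pseudo-minimal.  In a forest every
    vertex lies on some path of P, and a vertex of weight -1 and degree at most 2 is
    contractible because there are no triangles; so a forest is minimal exactly when no weight
    sequence along its paths contains -1. *)

(** * Sequences equivalent to the empty sequence *)

Definition inc_head (X : seq int) : seq int :=
  if X is x :: X' then (x + 1)%R :: X' else [::].

Definition inc_last (X : seq int) : seq int := rev (inc_head (rev X)).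

Lemma inc_last_rcons X x : inc_last (rcons X x) = rcons X (x + 1)%R.
Proof. by rewrite /inc_last rev_rcons /= rev_cons revK. Qed.

Lemma inc_last_cat X Y : Y != [::] -> inc_last (X ++ Y) = X ++ inc_last Y.
Proof.
case/lastP: Y => [//|Y y] _.
by rewrite -rcons_cat !inc_last_rcons rcons_cat.
Qed.

Lemma inc_headK X : inc_last (inc_head X) = inc_head (inc_last X).
Proof.
case: X => [|x [|y X]] //.
by rewrite /= -cat1s -[in RHS](cat1s x) !inc_last_cat.
Qed.

(** A blowing-up inserts -1 between a left part and a right part, either possibly empty,
    and decrements the adjacent terms.  Read from the blown-up sequence, with increments that
    do nothing on an empty part, the four kinds of blowing-up become one. *)
Lemma seq_blowupP X Y :
  seq_blowup X Y <->
  exists L R, Y = L ++ (-1)%R :: R /\ X = inc_last L ++ inc_head R.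
Proof.
split.
- case=> [|x Z|Z x y T|Z x].
  + by exists [::], [::].
  + by exists [::], ((x - 1)%R :: Z); rewrite /= subrK.
  + exists (rcons Z (x - 1)%R), ((y - 1)%R :: T).
    by rewrite inc_last_rcons /= !subrK !cat_rcons.
  + exists (rcons Z (x - 1)%R), [::].
    by rewrite inc_last_rcons /= !subrK cats0 cat_rcons cats1.
- case=> L [R [-> ->]]; case/lastP: L => [|L x]; case: R => [|y R].
  + exact: SeqBlowupNil.
  + by have := SeqBlowupLeft (y + 1)%R R; rewrite addrK.
  + have := SeqBlowupRight L (x + 1)%R.
    by rewrite addrK inc_last_rcons cats0 cat_rcons cats1.
  + have := SeqBlowupMid L (x + 1)%R (y + 1)%R R.
    by rewrite !addrK inc_last_rcons !cat_rcons.
Qed.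

Lemma seq_blowup_rev X Y : seq_blowup X Y -> seq_blowup (rev X) (rev Y).
Proof.
case/seq_blowupP=> L [R [-> ->]]; apply/seq_blowupP.
exists (rev R), (rev L); rewrite !rev_cat rev_cons cat_rcons; split=> //.
by rewrite /inc_last revK revK.
Qed.

Lemma seq_equiv_rev X Y : seq_equiv X Y -> seq_equiv (rev X) (rev Y).
Proof.
elim=> [? ? /seq_blowup_rev|?|? ? _|? ? ? _ + _].
- exact: rst_step.
- exact: rst_refl.
- exact: rst_sym.
- exact: rst_trans.
Qed.

Lemma seq_equiv_sym X Y : seq_equiv X Y -> seq_equiv Y X.
Proof. exact: rst_sym. Qed.

Inductive exceptional : seq int -> Prop :=
| Exceptional0 : exceptional [::]
| ExceptionalS X Y : exceptional X -> seq_blowup X Y -> exceptional Y.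

(** Contracting one of two adjacent terms -1 turns the other into 0, so it never yields an
    exceptional sequence. *)
Lemma exceptional_neg X : exceptional X -> {in X, forall x, (x < 0)%R}.
Proof.
elim=> [x //|{}X Y _ IH XY].
have H z : (z < 0 -> z - 1 < 0)%R by move=> z0; rewrite subr_lt0 (lt_trans z0).
case: XY IH => [|x Z|Z x y T|Z x] IH z; rewrite ?mem_cat !inE.
- by move/eqP->.
- by case/or3P=> [/eqP-> //|/eqP->|zZ]; [apply/H/IH|apply/IH];
    rewrite inE ?eqxx ?zZ ?orbT.
- by case/or3P=> [zZ|/eqP->|/or3P[/eqP->//|/eqP->|zZ]];
    [apply/IH|apply/H/IH|apply/H/IH|apply/IH];
    rewrite mem_cat !inE ?eqxx ?zZ ?orbT.
- by case/or3P=> [zZ|/eqP->|/eqP->//]; [apply/IH|apply/H/IH];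
    rewrite mem_cat !inE ?eqxx ?zZ ?orbT.
Qed.

(** Two contractions of the same sequence commute unless the contracted terms are
    neighbours, and then each turns the other term into 0. *)
Lemma seq_blowdown_diamond L M R :
  let X1 := inc_last L ++ inc_head (M ++ (-1)%R :: R) in
  let X2 := inc_last (L ++ (-1)%R :: M) ++ inc_head R in
  (0%R \in X1) && (0%R \in X2) \/
  exists Z, seq_blowup Z X1 /\ seq_blowup Z X2.
Proof.
(* M is empty exactly when the two contracted terms are neighbours. *)
case: M => [|m M] /=.
  by left; rewrite cats1 inc_last_rcons !mem_cat mem_rcons !inE /= ?addNr ?eqxx ?orbT.
right; exists (inc_last L ++ inc_last (inc_head (m :: M)) ++ inc_head R).
split; apply/seq_blowupP.
  exists (inc_last L ++ inc_head (m :: M)), R.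
  by rewrite inc_last_cat // -!catA.
exists L, (inc_last (m :: M) ++ inc_head R); split.
  by rewrite -cat1s catA inc_last_cat // -!catA.
rewrite inc_headK; case/lastP: (m :: M) (isT : m :: M != [::]) => // T t _.
by rewrite inc_last_rcons; case: T.
Qed.

Lemma cat_cons_eqP (T : eqType) (a : T) L R L' R' :
  L ++ a :: R = L' ++ a :: R' ->
  [\/ L = L' /\ R = R', exists M, L' = L ++ a :: M /\ R = M ++ a :: R'
    | exists M, L = L' ++ a :: M /\ R' = M ++ a :: R].
Proof.
elim: L L' => [|x L IH] [|y L'] /=.
- by case=> ->; constructor 1.
- by case=> -> ->; constructor 2; exists L'.
- by case=> -> <-; constructor 3; exists L.
- case=> -> /IH[[-> ->]|[M [-> ->]]|[M [-> ->]]].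
  + by constructor 1.
  + by constructor 2; exists M.
  + by constructor 3; exists M.
Qed.

(** By the diamond property and induction on the length: a sequence contracted in two
    ways, once to an exceptional sequence, has a common further contraction.  This is what makes
    the exceptional sequences a full equivalence class. *)
Lemma exceptional_blowdown X Y :
  seq_blowup X Y -> exceptional Y -> exceptional X.
Proof.
have sz A B : seq_blowup A B -> size B = (size A).+1.
  by case=> *; rewrite /= ?size_cat /= ?addnS.
have [n] := ubnP (size Y); elim: n X Y => // n IH X Y ltn XY exY.
case: exY XY ltn => [/sz//|X1 {}Y exX1 X1Y XY ltn].
have szX1 : size X1 < n by move: ltn; rewrite (sz _ _ X1Y).
have close : (0%R \in X1) && (0%R \in X) \/
    (exists Z, seq_blowup Z X1 /\ seq_blowup Z X) -> exceptional X.
  case=> [/andP[/(exceptional_neg exX1)]|[Z [ZX1 ZX]]]; first by rewrite ltxx.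
  by apply: ExceptionalS ZX; apply: IH ZX1 exX1.
case/seq_blowupP: XY close => L' [R' [YE ->]] close.
case/seq_blowupP: X1Y => L [R [E X1E]]; rewrite YE in E.
case: (cat_cons_eqP E) X1E close => [[-> ->] <- //|[M [-> ->]]|[M [-> ->]]] ->.
- apply; case: (seq_blowdown_diamond L' M R) => [|[Z [? ?]]].
    by rewrite andbC; left.
  by right; exists Z.
- by apply; exact: seq_blowdown_diamond.
Qed.

Lemma seq_equiv_exceptional X : seq_equiv X [::] -> exceptional X.
Proof.
suff H A B : seq_equiv A B -> (exceptional A <-> exceptional B).
  by case/H=> _; apply; exact: Exceptional0.
elim=> [Y Z YZ|//|Y Z _ [H1 H2]|Y Z T _ [H1 H2] _ [H3 H4]] //.
  by split=> [/ExceptionalS/(_ YZ)|/(exceptional_blowdown YZ)].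
by split=> [/H1/H3|/H4/H2].
Qed.

Lemma minimal_seq_equiv_nil X : minimal_seq X -> seq_equiv X [::] -> X = [::].
Proof.
move=> minX /seq_equiv_exceptional exX; case: exX minX => // Y Z _.
case/seq_blowupP=> L [R [-> _]]; by rewrite /minimal_seq mem_cat inE eqxx orbT.
Qed.

(** * Degrees and forests *)

Lemma adjC (G : graph) (x y : G) : adj x y = adj y x.
Proof. exact: adj_sym. Qed.

Lemma adj_neq (G : graph) (x y : G) : adj x y -> x != y.
Proof. by apply: contraTneq => ->; rewrite adj_irr. Qed.

Lemma size_nbrs_le_deg (G : graph) (x : G) (s : seq G) :
  uniq s -> all (adj x) s -> size s <= deg x.
Proof.
move=> us /allP xs; rewrite -(card_uniqP us).
by apply/subset_leq_card/subsetP => y /xs; rewrite inE.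
Qed.

Lemma deg_gt0P (G : graph) (x : G) :
  reflect (exists y, adj x y) (0 < deg x).
Proof.
rewrite /deg; apply: (iffP card_gt0P) => -[y xy]; exists y; by rewrite inE in xy *.
Qed.

Lemma deg_gt1P (G : graph) (x : G) :
  reflect (exists y z, [/\ adj x y, adj x z & y != z]) (1 < deg x).
Proof.
rewrite /deg; apply: (iffP card_gt1P) => -[y [z [xy xz yz]]]; exists y, z;
  by rewrite !inE in xy xz *.
Qed.

(** An edge from x to y would close the part of the path between them to a cycle. *)
Lemma no_chord (G : graph) (x u y : G) (l : seq G) : forest G ->
  uniq [:: x, u & l] -> path (@adj G) x (u :: l) -> y \in l -> ~~ adj x y.
Proof.
move=> forG uxl pxl yl; apply/negP=> xy.
case/splitPr: yl uxl pxl => l1 l2 uxl pxl.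
have := forG (x :: u :: rcons l1 y); rewrite /= size_rcons !ltnS ltn0.
move/(_ _)/notF; apply; apply/andP; split.
  rewrite /= rcons_path last_rcons (adjC y) xy andbT.
  by move: pxl; rewrite /= -cat_rcons cat_path; case/and3P=> -> ->.
by move: uxl; rewrite -cat_rcons -!cat_cons cat_uniq => /andP[].
Qed.

(** Unlike the absence of cycles, this form of being a forest is easily seen to be
    preserved by blowings-up and blowings-down. *)
Definition degenerate (G : graph) : Prop :=
  forall A : {set G}, A != set0 ->
    exists2 v, v \in A & #|[set u in A | adj v u]| <= 1.

(** If every vertex of A had two neighbours in A, a path inside A could be prolonged
    without end: one of the two neighbours of its end is not the preceding vertex, and by
    [no_chord] it is not an earlier one either. *)
Lemma forest_degenerate (G : graph) : forest G -> degenerate G.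
Proof.
move=> forG A A0.
case: (pickP [pred v in A | #|[set u in A | adj v u]| <= 1]) => [v /andP[]|no].
  by exists v.
have two v : v \in A -> exists y z, [/\ y \in A /\ adj v y, z \in A /\ adj v z & y != z].
  move=> vA; have:= no v; rewrite /= vA /= leqNgt => /negbFE/card_gt1P[y [z []]].
  by rewrite !inE => /andP[? ?] /andP[? ?] ?; exists y, z.
have ext n : exists x l, [/\ size l = n, uniq (x :: l), path (@adj G) x l
    & all (mem A) (x :: l)].
  elim: n => [|n [x [l [sl ul pl Al]]]].
    by case/set0Pn: A0 => x xA; exists x, [::]; rewrite /= xA.
  have xA : x \in A by case/andP: Al.
  suff [y [yA xy yl]] : exists y, [/\ y \in A, adj x y & y \notin x :: l].
    exists y, (x :: l); split=> /=; first by rewrite sl.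
    - by rewrite -/(uniq (x :: l)) ul andbT.
    - by rewrite adjC xy.
    - by rewrite yA.
  have [y [z [[yA xy] [zA xz] yz]]] := two x xA.
  case: l {sl Al} ul pl => [|u l] ul pl.
    by exists y; rewrite inE eq_sym adj_neq.
  have [t [tA xt tu]] : exists t, [/\ t \in A, adj x t & t != u].
    by have [yu|yu] := eqVneq y u; [exists z; rewrite -yu eq_sym|exists y].
  exists t; split=> //; rewrite !inE (negbTE tu) eq_sym (negbTE (adj_neq xt)) /=.
  by apply: contraL xt; apply: no_chord ul pl.
(* A path with #|G| + 1 vertices is absurd. *)
have [x [l [sl ul _ _]]] := ext #|G|.
by have := max_card (mem (x :: l)); rewrite (card_uniqP ul) /= sl ltnn.
Qed.

Lemma degenerate_forest (G : graph) : degenerate G -> forest G.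
Proof.
move=> degG c /andP[cc uc]; rewrite leqNgt; apply/negP=> sc.
have [|v] := degG [set x in c].
  by case: c sc {cc uc} => [//|x c _]; apply/set0Pn; exists x; rewrite inE mem_head.
rewrite inE => vc; apply/negP; rewrite -ltnNge.
case: (rot_to vc) => k c' E.
move: cc uc sc; rewrite -(rot_cycle k) -(rot_uniq k) -(size_rot k) E.
have c'c : {subset c' <= c}.
  by move=> x xc'; rewrite -(mem_rot k) E inE xc' orbT.
case: c' {E} c'c => [//|y c']; case/lastP: c' => [//|c' z] c'c.
rewrite /= rcons_path last_rcons => /and3P[vy _ zv] /and3P[_ + _] _.
rewrite mem_rcons inE negb_or => /andP[yz _].
apply/card_gt1P; exists y, z; rewrite !inE vy adjC zv yz !c'c //.
  by rewrite inE mem_rcons mem_head orbT.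
by rewrite mem_head.
Qed.

(** * The paths in P(G) *)

Definition deg2 (G : graph) : pred G := fun x => deg x == 2.

Inductive epath_spec (G : graph) (s : seq G) : Prop :=
| EpathPoint v of s = [:: v] & deg v = 0
| EpathLong v m w of s = v :: rcons m w & uniq s & path (@adj G) v (rcons m w)
    & deg v != 2 & deg w != 2 & all (@deg2 G) m.

Lemma is_epath_rcons (G : graph) (v w : G) (m : seq G) :
  is_epath (v, rcons m w) =
  [&& uniq (v :: rcons m w), path (@adj G) v (rcons m w), deg v != 2, deg w != 2
    & all (@deg2 G) m].
Proof.
rewrite /is_epath; case E: (rcons m w) => [|a l]; first by case: (m) E.
rewrite -E; do 2 congr (_ && _); rewrite size_rcons.
apply/forallP/and3P => [H|[dv dw /allP dm] [i /= lei]].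
  split.
  - by have /= := H ord0; rewrite eqb_id.
  - have /= := H (inord (size m).+1).
    by rewrite inordK //= nth_rcons ltnn !eqxx eqb_id.
  - apply/allP=> x xm; have := H (inord (index x m).+1).
    have ltx : index x m < size m by rewrite index_mem.
    rewrite inordK ?ltnS 1?ltnW //= nth_rcons ltx nth_index // eqSS.
    by rewrite (ltn_eqF ltx) /= /deg2; case: (deg x == 2).
case: i lei => [|i] /=; first by rewrite dv.
rewrite !ltnS => lei; rewrite nth_rcons eqSS.
case: ltngtP lei => // [lti _|_ _]; last by rewrite dw.
by have := dm _ (mem_nth v lti); rewrite /deg2 => ->.
Qed.

Lemma epathP (G : graph) (g : epath G) : epath_spec (pseq g).
Proof.
case: g => -[v p] H; rewrite /pseq [val _]/=; case/lastP: p H => [|m w] H.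
  by apply: EpathPoint (eqP H).
by move: (H); rewrite is_epath_rcons => /and5P[]; apply: EpathLong.
Qed.

Lemma epath_of_spec (G : graph) (s : seq G) :
  epath_spec s -> exists g : epath G, pseq g = s.
Proof.
case=> [v -> dv|v m w -> u p dv dw dm].
  have H : is_epath (v, [::]) by rewrite /= dv.
  by exists (exist (fun g => is_epath g) _ H).
have H : is_epath (v, rcons m w) by rewrite is_epath_rcons u p dv dw.
by exists (exist (fun g => is_epath g) _ H).
Qed.

Lemma pseq_inj (G : graph) : injective (@pseq G).
Proof. by move=> [[v p] H] [[v' p'] H'] [/= E E']; apply: val_inj; rewrite /= E E'. Qed.

Lemma src_pseq (G : graph) (g : epath G) v p : pseq g = v :: p -> val (src g) = v.
Proof. by case. Qed.

Lemma tgt_pseq (G : graph) (g : epath G) v p :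
  pseq g = v :: p -> val (tgt g) = last v p.
Proof. by case=> /= -> ->. Qed.

Lemma pseq_cons (G : graph) (g : epath G) : exists p, pseq g = val (src g) :: p.
Proof. by exists (val g).2. Qed.

Lemma src_tgt_deg0 (G : graph) (g : epath G) :
  src g = tgt g -> deg (val (src g)) = 0.
Proof.
move=> E; case: (epathP g) => [v s dv|v m w s + _ _ _ _].
  by rewrite (src_pseq s).
have:= congr1 val E; rewrite (src_pseq s) (tgt_pseq s) last_rcons => vw.
by rewrite s vw /= mem_rcons mem_head.
Qed.

Lemma src_deg0_tgt (G : graph) (g : epath G) :
  deg (val (src g)) = 0 -> pseq g = [:: val (src g)].
Proof.
case: (epathP g) => [v s _|v m w s _ p _ _ _]; rewrite (src_pseq s) //.
move=> d0; have: 0 < deg v; last by rewrite d0.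
by apply/deg_gt0P; case: m p {s} => [|x m] /= /andP[]; eexists; eassumption.
Qed.

Lemma src_rev (G : graph) (g : epath G) : src (rev_epath g) = tgt g.
Proof. exact: val_inj. Qed.

Lemma tgt_rev (G : graph) (g : epath G) : tgt (rev_epath g) = src g.
Proof.
apply: val_inj; have := pseq_rev_epath g; rewrite /pseq /= => E.
by rewrite -[LHS](last_cons (val g).1) E rev_cons last_rcons.
Qed.

Lemma rev_epathK (G : graph) : involutive (@rev_epath G).
Proof. by move=> g; apply: pseq_inj; rewrite !pseq_rev_epath revK. Qed.

Lemma sorted_adj_rev (G : graph) (s : seq G) :
  sorted (@adj G) (rev s) = sorted (@adj G) s.
Proof. by rewrite rev_sorted; apply: eq_sorted => x y; rewrite adjC. Qed.

Lemma interior_nbrs (G : graph) (v z w : G) (m : seq G) :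
  uniq (v :: rcons m w) -> path (@adj G) v (rcons m w) -> z \in m ->
  exists a b, [/\ a \in v :: rcons m w, b \in v :: rcons m w,
    adj z a, adj z b & a != b].
Proof.
move=> us ps zm; case/splitPr: zm us ps => m1 m2.
rewrite rcons_cat rcons_cons cat_path /= => us /and3P[_ az zb].
have [b [m3 E]] : exists b m3, rcons m2 w = b :: m3.
  by case: m2 {us zb} => [|b m3]; eexists _, _.
rewrite E in us zb *; exists (last v m1), b; move: zb => /= /andP[zb _].
rewrite adjC az zb -cat_cons !mem_cat mem_last !inE eqxx !orbT; split=> //.
move: us; rewrite -/(uniq (v :: m1 ++ z :: b :: m3)) -cat_cons cat_uniq.
have bz : b \in [:: z, b & m3] by rewrite !inE eqxx orbT.
case/and3P=> _ /hasPn/(_ b bz) + _.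
by apply: contraNneq => <-; rewrite mem_last.
Qed.

Definition straight (G : graph) (u x : G) (p : seq G) : bool :=
  [&& uniq [:: u, x & p], path (@adj G) u (x :: p), all (@deg2 G) (belast x p)
    & ~~ deg2 (last x p)].

(** A vertex of degree 2 entered from one neighbour can only be left towards the other. *)
Lemma straight_det (G : graph) (u x : G) (p p' : seq G) :
  straight u x p -> straight u x p' -> p = p'.
Proof.
elim: p p' u x => [|y p IH] [|y' p'] u x //.
- by case/and4P=> _ _ _ /negP/= ndx /and4P[_ _ /andP[]].
- by move=> + /and4P[_ _ _ /negP/= ndx]; case/and4P=> _ _ /andP[].
case/and4P=> U P /= /andP[dx D] L /and4P[U' P' /= /andP[_ D'] L'].
have yy' : y = y'.
  move: (P) (P') => /= /and3P[ux xy _] /and3P[_ xy' _].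
  apply: contraTeq (dx) => nyy'; apply/eqP => dx2.
  have := @size_nbrs_le_deg _ x [:: u; y; y'].
  rewrite dx2 /= adjC ux xy xy' !inE negb_or nyy' andbT => H.
  move: (U) (U') => /= /and3P[+ _ _] /and3P[+ _ _]; rewrite !inE !negb_or.
  by case/and3P=> _ uy _ /and3P[_ uy' _];  move: H; rewrite uy uy' => /(_ isT isT).
rewrite -yy' in U' P' D' L' *; congr (_ :: _); apply: (IH _ x y).
  by apply/and4P; split=> //; [case/andP: U|case/andP: P].
by apply/and4P; split=> //; [case/andP: U'|case/andP: P'].
Qed.

Lemma epath_straight (G : graph) (g : epath G) v x p :
  pseq g = [:: v, x & p] -> straight v x p.
Proof.
case: (epathP g) => [? -> _ //|a m w E U P da dw dm E'].
have [E1 E2] : a = v /\ rcons m w = x :: p by move: E'; rewrite E; case.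
rewrite E -E1 in E' U *; rewrite E1 E2 in U P *.
apply/and4P; split=> //.
  have : belast x p = m; last by move->.
  by move: E2; rewrite lastI => /rcons_inj[].
by move: E2; rewrite lastI => /rcons_inj[_ <-].
Qed.

Lemma epath_det (G : graph) (g g' : epath G) v x p p' :
  pseq g = [:: v, x & p] -> pseq g' = [:: v, x & p'] -> g = g'.
Proof.
move=> E E'; apply: pseq_inj; rewrite E E'.
by rewrite (straight_det (epath_straight E) (epath_straight E')).
Qed.

(** Every vertex on the paths in L would have two neighbours on these paths, against
    [forest_degenerate]: a vertex inside a path has both of its neighbours there, and at an end
    vertex two different paths with that source diverge at the first step, by [epath_det].
    The uniqueness of the path between given ends and the absence of triangles of paths are
    the two cases of interest. *)
Lemma no_epath_cycle (G : graph) (L : seq (epath G)) : forest G ->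
  L != [::] -> {in L, forall g, rev_epath g \in L} ->
  {in L, forall g, exists2 g', g' \in L & src g' = src g /\ g' != g} -> False.
Proof.
move=> /forest_degenerate degG L0 Lrev Lbranch.
have two v : v \in [set v | has (fun g => val (src g) == v) L] ->
    exists a b, [/\ adj v a /\ has (fun g => a \in pseq g) L,
      adj v b /\ has (fun g => b \in pseq g) L & a != b].
  rewrite inE => /hasP[g gL /eqP sg]; have [g' g'L [sg' gg']] := Lbranch g gL.
  have second h : h \in L -> val (src h) = v -> exists x p, pseq h = [:: v, x & p].
    move=> hL sh; have [p] := pseq_cons h; rewrite sh.
    case: p => [|x p] E; last by exists x, p.
    have [h' _ [sh' /eqP[]]] := Lbranch h hL; apply: pseq_inj.
    have d0 : deg (val (src h)) = 0.
      by apply: src_tgt_deg0; apply: val_inj; rewrite (src_pseq E) (tgt_pseq E).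
    by rewrite !src_deg0_tgt ?sh'.
  have [a [p E]] := second g gL sg.
  have [b [q E']] := second g' g'L (etrans (congr1 val sg') sg).
  have ab : a != b.
    by apply: contra_neq gg' => ab; rewrite -ab in E'; apply: epath_det E' E.
  have adj2 h x l : pseq h = [:: v, x & l] -> adj v x.
    by move/epath_straight; case/and4P=> _ /andP[].
  exists a, b; split=> //; split; do ?[exact: adj2 E|exact: adj2 E'].
    by apply/hasP; exists g; rewrite // E !inE eqxx orbT.
  by apply/hasP; exists g'; rewrite // E' !inE eqxx orbT.
have [|z] := degG [set v | has (fun g => v \in pseq g) L].
  case: L L0 {Lrev Lbranch two} => // g L _; apply/set0Pn; exists (val (src g)).
  by rewrite inE /= mem_head.
rewrite inE => zL; apply/negP; rewrite -ltnNge.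
suff [a [b [[za aL] [zb bL] ab]]] : exists a b,
    [/\ adj z a /\ has (fun g => a \in pseq g) L,
      adj z b /\ has (fun g => b \in pseq g) L & a != b].
  by apply/card_gt1P; exists a, b; rewrite !in_set za zb aL bL ab.
have endz (g : epath G) : g \in L -> val (src g) = z \/ val (tgt g) = z ->
    z \in [set v | has (fun g => val (src g) == v) L].
  move=> gL [E|E]; rewrite inE; apply/hasP; first by exists g; rewrite ?E.
  by exists (rev_epath g); rewrite ?Lrev // src_rev E.
case/hasP: zL => g gL zg.
case: (epathP g) => [v s dv|v m w s U P dv dw dm].
  apply/two/(endz g gL); left; rewrite (src_pseq s).
  by move: zg; rewrite s inE => /eqP.
move: zg; rewrite s !(inE, mem_rcons) => /or3P[/eqP zv|/eqP zw|zm].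
- by apply/two/(endz g gL); left; rewrite (src_pseq s).
- by apply/two/(endz g gL); right; rewrite (tgt_pseq s) last_rcons.
rewrite s in U; have [a [b [am bm za zb ab]]] := interior_nbrs U P zm.
by exists a, b; split=> //; split=> //; apply/hasP; exists g; rewrite // s.
Qed.

Lemma epath_unique (G : graph) (g g' : epath G) :
  forest G -> src g = src g' -> tgt g = tgt g' -> g = g'.
Proof.
move=> forG ss tt; apply/eqP/negPn/negP => gg'.
have rgg' : rev_epath g != rev_epath g' by rewrite (can_eq (@rev_epathK G)).
apply: (@no_epath_cycle _ [:: g; g'; rev_epath g; rev_epath g'] forG) => // h.
  by rewrite !inE => /or4P[] /eqP->; rewrite ?rev_epathK eqxx ?orbT.
rewrite !inE => /or4P[] /eqP->.
- by exists g'; rewrite ?inE ?eqxx ?orbT // eq_sym.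
- by exists g; rewrite ?inE ?eqxx ?orbT.
- by exists (rev_epath g'); rewrite ?inE ?eqxx ?orbT // !src_rev eq_sym.
- by exists (rev_epath g); rewrite ?inE ?eqxx ?orbT // !src_rev.
Qed.

Lemma no_epath_triangle (G : graph) (g1 g2 g3 : epath G) : forest G ->
  tgt g1 = src g2 -> tgt g2 = src g3 -> tgt g3 = src g1 ->
  src g1 != src g2 -> src g2 != src g3 -> src g3 != src g1 -> False.
Proof.
move=> forG t1 t2 t3 n12 n23 n31.
pose L := [:: g1; g2; g3; rev_epath g1; rev_epath g2; rev_epath g3].
have neq (g h : epath G) : tgt g != tgt h -> g != h by apply: contra_neq => ->.
apply: (@no_epath_cycle _ L forG) => // h; rewrite !inE.
  case/orP=> [|/orP[|/or4P[]]] /eqP->; by rewrite ?rev_epathK eqxx ?orbT.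
case/orP=> [|/orP[|/or4P[]]] /eqP->.
- exists (rev_epath g3); rewrite ?inE ?eqxx ?orbT // src_rev; split=> //.
  by apply: neq; rewrite tgt_rev t1 eq_sym.
- exists (rev_epath g1); rewrite ?inE ?eqxx ?orbT // src_rev; split=> //.
  by apply: neq; rewrite tgt_rev t2 eq_sym.
- exists (rev_epath g2); rewrite ?inE ?eqxx ?orbT // src_rev; split=> //.
  by apply: neq; rewrite tgt_rev t3 eq_sym.
- exists g2; rewrite ?inE ?eqxx ?orbT // src_rev; split=> //.
  by apply: neq; rewrite tgt_rev t2.
- exists g3; rewrite ?inE ?eqxx ?orbT // src_rev; split=> //.
  by apply: neq; rewrite tgt_rev t3.
- exists g1; rewrite ?inE ?eqxx ?orbT // src_rev; split=> //.
  by apply: neq; rewrite tgt_rev t1.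
Qed.

(** Prolongs a path through vertices of degree 2 until it meets a vertex of another
    degree; in a forest it cannot run into itself, by [no_chord].  The growing end is at the head
    of the list. *)
Lemma extend_path (G : graph) (x u : G) (l : seq G) : forest G ->
  uniq [:: x, u & l] -> path (@adj G) x (u :: l) ->
  exists y m, [/\ uniq (y :: m ++ u :: l), path (@adj G) y (m ++ u :: l),
    deg y != 2, all (@deg2 G) m & last y m = x].
Proof.
move=> forG; have [n] := ubnP (#|G| - size l).
elim: n x u l => // n IH x u l; rewrite ltnS => len U P.
have [dx|dx] := boolP (deg2 x); last by exists x, [::].
have [t [xt tu]] : exists t, adj x t /\ t != u.
  have [y [z [xy xz yz]]] : exists y z, [/\ adj x y, adj x z & y != z].
    by apply/deg_gt1P; rewrite (eqP dx).
  by have [yu|yu] := eqVneq y u; [exists z; rewrite -yu eq_sym|exists y].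
have tl : t \notin l by apply: contraL xt; apply: no_chord U P.
have Ut : uniq [:: t, x, u & l].
  by rewrite cons_uniq U !inE (negbTE tu) (negbTE tl) eq_sym (negbTE (adj_neq xt)).
have szl : size [:: t, x, u & l] <= #|G|.
  by have := max_card (mem [:: t, x, u & l]); rewrite (card_uniqP Ut).
have [||y [m [Um Pm dy dm lm]]] := IH t x (u :: l) _ Ut.
- by apply: leq_trans len; rewrite /= subnS prednK // subn_gt0 (leq_trans _ szl) //= ltnS leqW.
- by rewrite /= adjC xt.
exists y, (rcons m x); rewrite cat_rcons; split=> //; last by rewrite last_rcons.
by rewrite all_rcons dx.
Qed.

Lemma edge_epath (G : graph) (a x : G) : forest G -> deg a != 2 -> adj a x ->
  exists g : epath G, exists p, pseq g = [:: a, x & p].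
Proof.
move=> forG da ax.
have [||y [m [U P dy dm lm]]] := @extend_path G x a [::] forG.
- by rewrite /= inE eq_sym adj_neq.
- by rewrite /= adjC ax.
have E : rev (y :: m ++ [:: a]) = a :: rcons (rev m) y.
  by rewrite cats1 -rcons_cons rev_rcons rev_cons.
have [|g sg] := @epath_of_spec G (a :: rcons (rev m) y).
  apply: (EpathLong (erefl _)); rewrite // ?all_rev // -?E ?rev_uniq //.
  by rewrite -/(sorted (@adj G) (a :: rcons (rev m) y)) -E sorted_adj_rev.
exists g; rewrite sg; case/lastP: m lm {U P dm E sg} => [<-|m z] /=.
  by exists [::].
by rewrite last_rcons rev_rcons => <-; eexists.
Qed.

(** Prolong the path formed by the vertex and its neighbours in both directions. *)
Lemma vertex_on_epath (G : graph) (v : G) : forest G ->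
  exists g : epath G, v \in pseq g.
Proof.
move=> forG; have [d0|] := posnP (deg v).
  by have [g sg] := epath_of_spec (EpathPoint (erefl [:: v]) d0); exists g; rewrite sg mem_head.
move=> dv; have [dv2|dv2] := eqVneq (deg v) 2; last first.
  have [x vx] := deg_gt0P _ dv; have [g [p sg]] := edge_epath forG dv2 vx.
  by exists g; rewrite sg mem_head.
have [a [b [va vb ab]]] : exists a b, [/\ adj v a, adj v b & a != b].
  by apply/deg_gt1P; rewrite dv2.
have [||y [m [U P dy dm lm]]] := @extend_path G a v [:: b] forG.
- by rewrite /= !inE eq_sym negb_or adj_neq // ab adj_neq.
- by rewrite /= adjC va vb.
have E : rev (y :: m ++ [:: v; b]) = [:: b, v & rcons (rev m) y].
  by rewrite -cat_cons rev_cat (rev_cons y).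
have [||y' [m' [U' P' dy' dm' lm']]] := @extend_path G b v (rcons (rev m) y) forG.
- by rewrite -E rev_uniq.
- by rewrite -/(sorted (@adj G) [:: b, v & rcons (rev m) y]) -E sorted_adj_rev.
have [|g sg] := @epath_of_spec G (y' :: rcons (m' ++ v :: rev m) y).
  apply: (EpathLong (erefl _)); rewrite // -?cats1 -?catA /= ?cats1 //.
  by rewrite all_cat /= all_rev dm dm' /deg2 dv2.
by exists g; rewrite sg !(inE, mem_rcons, mem_cat) eqxx !orbT.
Qed.

(** * Isomorphisms *)

Definition wiso (G H : wgraph) : Prop := exists phi : G -> H,
  [/\ bijective phi, forall x y, adj (phi x) (phi y) = adj x y
    & forall x, wt (phi x) = wt x].

Lemma wiso_refl (G : wgraph) : wiso G G.
Proof. by exists id; split=> //; exists id. Qed.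

Lemma wiso_sym (G H : wgraph) : wiso G H -> wiso H G.
Proof.
case=> phi [[psi K K'] a w]; exists psi; split; first by exists phi.
  by move=> x y; rewrite -a !K'.
by move=> x; rewrite -w K'.
Qed.

Lemma wiso_trans (G H K : wgraph) : wiso G H -> wiso H K -> wiso G K.
Proof.
case=> f [bf af wf] [g [bg ag wg]]; exists (g \o f); split; first exact: bij_comp.
  by move=> x y /=; rewrite ag af.
by move=> x /=; rewrite wg wf.
Qed.

(** Iterated contractions of one graph have different vertex types that embed in the
    vertex type T of that graph; this compares them inside T. *)
Lemma wiso_emb (T : eqType) (G H : wgraph) (f : G -> T) (g : H -> T) :
  injective f -> injective g ->
  (forall x, exists y, g y == f x) -> (forall y, exists x, f x == g y) ->
  (forall x x' y y', f x = g y -> f x' = g y' -> adj x x' = adj y y') ->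
  (forall x y, f x = g y -> wt x = wt y) -> wiso G H.
Proof.
move=> fI gI fg gf Hadj Hwt.
pose phi x := xchoose (fg x); pose psi y := xchoose (gf y).
have phiP x : f x = g (phi x) by apply/esym/eqP/(xchooseP (fg x)).
have psiP y : f (psi y) = g y by apply/eqP/(xchooseP (gf y)).
exists phi; split.
- by exists psi => x; [apply: fI|apply: gI]; rewrite ?psiP -?phiP ?psiP.
- by move=> x y; apply/esym/Hadj.
- by move=> x; apply/esym/Hwt.
Qed.

Lemma deg_iso (G H : graph) (phi : G -> H) :
  bijective phi -> (forall x y, adj (phi x) (phi y) = adj x y) ->
  forall x, deg (phi x) = deg x.
Proof.
move=> bphi a x; rewrite /deg -(card_imset [set u | adj x u] (bij_inj bphi)).
case: bphi => psi K K'; apply: eq_card => y; rewrite inE.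
by rewrite -{1}[y]K' a -[y in RHS]K' mem_imset ?inE //; apply: can_inj K.
Qed.

Lemma contractible_iso (G H : wgraph) (phi : G -> H) :
  bijective phi -> (forall x y, adj (phi x) (phi y) = adj x y) ->
  (forall x, wt (phi x) = wt x) ->
  forall x, contractible x -> contractible (phi x).
Proof.
move=> bphi a w x [wx dx nx]; split; rewrite ?w ?(deg_iso bphi) //.
case: (bphi) => psi K K' u v; rewrite -[u]K' -[v]K' !a => xu xv.
by rewrite (inj_eq (can_inj K)) => uv; apply: nx.
Qed.

Lemma minimal_iso (G H : wgraph) : wiso G H -> minimal_graph G -> minimal_graph H.
Proof.
case/wiso_sym=> phi [bphi a w] minG e ce; apply: (minG (phi e)).
exact: contractible_iso.
Qed.

Lemma degenerate_iso (G H : wgraph) : wiso G H -> degenerate G -> degenerate H.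
Proof.
case=> phi [[psi K K'] a w] degG A /set0Pn[y yA].
have [|v] := degG (phi @^-1: A).
  by apply/set0Pn; exists (psi y); rewrite inE K'.
rewrite inE => vA le1; exists (phi v) => //; apply: leq_trans le1.
rewrite -(card_imset _ (can_inj K)); apply/subset_leq_card/subsetP => u.
rewrite !inE => /andP[uA vu]; apply/imsetP; exists (psi u); rewrite ?K' //.
by rewrite !inE K' uA -a K'.
Qed.

(** * Blowings-up along a clique *)

Definition clique (G : graph) (A : {set G}) : Prop :=
  forall x y, x \in A -> y \in A -> x != y -> adj x y.

(** Working with cliques of at most two elements treats the three kinds of blowing-up
    together. *)
Lemma blowup_kindP (G : graph) (A : {set G}) :
  [\/ exists v, at_vertex v A, exists v1 v2, at_edge v1 v2 A | Defs.free A] <->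
  #|A| <= 2 /\ clique A.
Proof.
split=> [[[v ->]|[v1 [v2 [v12 ->]]]|->]|[]].
- by rewrite cards1; split=> // x y /set1P-> /set1P->; rewrite eqxx.
- rewrite cards2 adj_neq //; split=> // x y.
  by do 2 (case/set2P=> ->); rewrite ?eqxx // adjC.
- by rewrite cards0; split=> // x y; rewrite inE.
case E: #|A| => [|[|[|//]]] _ cA.
- by apply: Or33; apply/eqP; rewrite -cards_eq0 E.
- by have /eqP/cards1P[v EA] := E; apply: Or31; exists v.
- have /eqP/cards2P[v1 [v2 [v12 EA]]] := E.
  by apply: Or32; exists v1, v2; split=> //; apply: cA; rewrite // EA !inE eqxx ?orbT.
Qed.

Lemma clique2P (G : graph) (A : {set G}) (x : G) :
  #|A| = 2 -> clique A -> x \in A ->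
  exists y, [/\ A = [set x; y], x != y & adj x y].
Proof.
move=> c2 cA xA; have := cardsD1 x A; rewrite c2 xA => -[/esym/eqP/cards1P[y E]].
have EA : A = [set x; y] by rewrite -E setD1K.
have xy : x != y by move: c2; rewrite EA cards2; case: eqP.
by exists y; split=> //; apply: cA; rewrite // EA !inE eqxx ?orbT.
Qed.

Lemma blowup_along_cases (G F : wgraph) (A : {set G}) (e : F) (i : G -> F) z :
  blowup_along A e i -> z = e \/ exists x, z = i x.
Proof.
case=> -[_ ine] _ _ _; have [->|ze] := eqVneq z e; first by left.
by right; apply/ine.
Qed.

Lemma deg_exceptional (G F : wgraph) (A : {set G}) (e : F) (i : G -> F) :
  blowup_along A e i -> deg e = #|A|.
Proof.
move=> bl; have [[iI ine] _ ae _] := bl; rewrite -(card_imset A iI) /deg.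
apply: eq_card => z; rewrite inE.
have [->|[x ->]] := blowup_along_cases z bl; last by rewrite ae mem_imset.
rewrite adj_irr; apply/esym/imsetP=> -[x _ ex].
by have /ine := ex_intro (fun x => e = i x) x ex; rewrite eqxx.
Qed.

(** The new vertex joins the neighbours of x when x is in A, and x loses its neighbours
    in A. *)
Lemma deg_blowup (G F : wgraph) (A : {set G}) (e : F) (i : G -> F) x :
  blowup_along A e i ->
  deg (i x) = (x \in A) + #|[set y | adj x y & ~~ ((x \in A) && (y \in A))]|.
Proof.
move=> bl; have [[iI ine] _ ae ai] := bl.
have ie y : i y != e by apply/ine; exists y.
rewrite /deg (cardsD1 e) inE adjC ae; congr (_ + _).
rewrite -(card_imset _ iI); apply: eq_card => z; rewrite !inE.
have [->|[y ->]] := blowup_along_cases z bl.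
  by rewrite eqxx; apply/esym/imsetP=> -[y _ /esym/eqP]; rewrite (negbTE (ie y)).
by rewrite ie mem_imset // inE ai.
Qed.

Lemma deg_blowup_notin (G F : wgraph) (A : {set G}) (e : F) (i : G -> F) x :
  blowup_along A e i -> x \notin A -> deg (i x) = deg x.
Proof.
move=> bl xA; rewrite (deg_blowup x bl) (negbTE xA) add0n.
by apply: eq_card => y; rewrite !inE andbT.
Qed.

Lemma deg_blowup_edge (G F : wgraph) (A : {set G}) (e : F) (i : G -> F) x :
  blowup_along A e i -> clique A -> #|A| = 2 -> deg (i x) = deg x.
Proof.
move=> bl cA A2; have [xA|] := boolP (x \in A); last exact: (deg_blowup_notin bl).
rewrite (deg_blowup x bl) xA; have [y [E xy axy]] := clique2P A2 cA xA.
rewrite /deg [in RHS](cardsD1 y) inE axy; congr (_ + _); apply: eq_card => z.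
rewrite !inE E !inE negb_or andbC; case axz: (adj x z); rewrite ?andbF // !andbT.
by rewrite eq_sym (negbTE (adj_neq axz)).
Qed.

Lemma deg_blowup_vertex (G F : wgraph) (v : G) (e : F) (i : G -> F) :
  blowup_along [set v] e i -> deg (i v) = (deg v).+1.
Proof.
move=> bl; rewrite (deg_blowup v bl) !inE eqxx add1n; congr _.+1.
apply: eq_card => z; rewrite !inE; case vz: (adj v z) => //=.
by rewrite eq_sym (negbTE (adj_neq vz)).
Qed.

Lemma deg_blowup_ge (G F : wgraph) (A : {set G}) (e : F) (i : G -> F) x :
  blowup_along A e i -> #|A| <= 2 -> clique A -> deg x <= deg (i x).
Proof.
move=> bl A2 cA; have [xA|xA] := boolP (x \in A); last first.
  by rewrite (deg_blowup_notin bl xA).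
case E: #|A| A2 => [|[|[|//]]] _.
- by move/eqP: E; rewrite cards_eq0 => /eqP E; rewrite E inE in xA.
- move/eqP/cards1P: E => [v E]; move: xA bl; rewrite E => /set1P-> bl.
  by rewrite (deg_blowup_vertex bl).
- by rewrite (deg_blowup_edge x bl cA E).
Qed.

(** If e is in B and has at most one neighbour there, it is the vertex sought.  Otherwise a
    vertex with at most one neighbour in the trace of B on G will do: if e is in B, then so are both
    elements of A, each of which exchanges the other for e. *)
Lemma blowup_degenerate (G F : wgraph) (A : {set G}) (e : F) (i : G -> F) :
  blowup_along A e i -> #|A| <= 2 -> clique A ->
  degenerate G -> degenerate F.
Proof.
move=> bl A2 cA degG B B0; have [[iI ine] _ ae ai] := bl.
have [e1|] := boolP ((e \in B) && (#|[set u in B | adj e u]| <= 1)).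
  by case/andP: e1; exists e.
rewrite negb_and -ltnNge => eB.
have [v] : exists2 v, v \in i @^-1: B & #|[set u in i @^-1: B | adj v u]| <= 1.
  apply: degG; apply/set0Pn; case/orP: eB => [eB|].
    case/set0Pn: B0 => z zB; have [ze|[x xz]] := blowup_along_cases z bl.
      by rewrite -ze zB in eB.
    by exists x; rewrite inE -xz.
  case/ltnW/card_gt0P=> z; rewrite inE => /andP[zB ez].
  have [ze|[x xz]] := blowup_along_cases z bl; first by rewrite ze adj_irr in ez.
  by exists x; rewrite inE -xz.
rewrite inE => vB le1; exists (i v) => //; apply: leq_trans le1.
have [/andP[vA eB']|] := boolP ((v \in A) && (e \in B)); last first.
  rewrite negb_and => H; rewrite -(card_imset _ iI).
  apply/subset_leq_card/subsetP => z; rewrite inE => /andP[zB].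
  have [ze|[x zx]] := blowup_along_cases z bl.
    by move: H; rewrite ze adjC ae => + vA; rewrite vA -ze zB.
  by rewrite zx ai => /andP[vx _]; rewrite mem_imset // !inE vx -zx zB.
have {eB} e2 : 1 < #|[set u in B | adj e u]| by move: eB; rewrite eB'.
have eBA : [set u in B | adj e u] \subset i @: A.
  apply/subsetP => z; rewrite inE => /andP[_].
  have [->|[x ->]] := blowup_along_cases z bl; first by rewrite adj_irr.
  by rewrite ae mem_imset.
have cA2 : #|A| = 2.
  apply/eqP; rewrite eqn_leq A2 -(card_imset A iI).
  by apply: leq_trans e2 _; apply: subset_leq_card.
have E : [set u in B | adj e u] = i @: A.
  by apply/eqP; rewrite eqEcard eBA card_imset // cA2.
have [w [EA vw avw]] := clique2P cA2 cA vA.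
have wB : i w \in B.
  have : i w \in i @: A by rewrite mem_imset // EA !inE eqxx orbT.
  by rewrite -E inE => /andP[].
rewrite (cardsD1 e) [X in _ <= X](cardsD1 w) !inE eB' adjC ae vA wB avw leq_add2l.
rewrite -(card_imset _ iI); apply/subset_leq_card/subsetP => z.
rewrite !inE => /and3P[ze zB]; have [E'|[x E']] := blowup_along_cases z bl.
  by rewrite E' eqxx in ze.
rewrite E' in zB *; rewrite ai mem_imset // vA !inE => /andP[-> xA].
rewrite zB !andbT; apply: contraNneq xA => ->.
by rewrite EA !inE eqxx orbT.
Qed.

(** If B contains the blown-up edge, enlarge its image by e.  Then e has two neighbours
    there, so the vertex with at most one neighbour is another one, for which e replaces the
    other end of the edge. *)
Lemma blowdown_degenerate (G F : wgraph) (A : {set G}) (e : F) (i : G -> F) :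
  blowup_along A e i -> #|A| <= 2 -> clique A ->
  degenerate F -> degenerate G.
Proof.
move=> bl A2 cA degF B /set0Pn[b bB]; have [[iI ine] _ ae ai] := bl.
have ie y : i y != e by apply/ine; exists y.
have [H|H] := leqP #|A :&: B| 1.
  have [|_ /imsetP[v vB ->] le1] := degF (i @: B).
    by apply/set0Pn; exists (i b); rewrite mem_imset.
  exists v => //; apply: leq_trans le1; rewrite -(card_imset _ iI).
  apply/subset_leq_card/subsetP => _ /imsetP[x + ->]; rewrite !inE.
  case/andP=> xB vx; rewrite mem_imset // xB ai vx /=; apply/negP=> /andP[vA xA].
  move/card_le1_eqP: H => /(_ v x); rewrite !inE vA xA vB xB => /(_ isT isT).
  by move/eqP; rewrite eq_sym (negbTE (adj_neq vx)).
have cA2 : #|A| = 2.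
  apply/eqP; rewrite eqn_leq A2 (leq_trans H) //.
  by apply/subset_leq_card/subsetIl.
have AB : A \subset B.
  by apply/setIidPl/eqP; rewrite eqEcard subsetIl cA2.
have [|z zB le1] := degF (e |: i @: B).
  by apply/set0Pn; exists e; rewrite !inE eqxx.
have [Ez|[v Ez]] := blowup_along_cases z bl.
  have: #|A| <= 1; last by rewrite cA2.
  apply: leq_trans le1; rewrite Ez -(card_imset A iI).
  apply/subset_leq_card/subsetP => _ /imsetP[x xA ->].
  by rewrite !inE ae xA (mem_imset _ _ iI) (subsetP AB) // orbT.
move: zB le1; rewrite Ez !inE (negbTE (ie v)) mem_imset //= => vB le1.
exists v => //; apply: leq_trans le1.
have [vA|vA] := boolP (v \in A); last first.
  rewrite -(card_imset _ iI); apply/subset_leq_card/subsetP => _ /imsetP[x + ->].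
  by rewrite !inE ai (negbTE vA) andbT mem_imset // => /andP[-> ->]; rewrite orbT.
have [w [EA vw avw]] := clique2P cA2 cA vA.
rewrite (cardsD1 w) [X in _ <= X](cardsD1 e) !inE eqxx (adjC (i v)) ae vA avw /=.
rewrite (subsetP AB) ?EA ?inE ?eqxx ?orbT // leq_add2l -(card_imset _ iI).
apply/subset_leq_card/subsetP => _ /imsetP[x + ->]; rewrite !inE => /and3P[xw xB vx].
rewrite ie mem_imset // xB orbT ai vx vA EA !inE (negbTE xw) orbF /=.
by rewrite eq_sym adj_neq.
Qed.

(** * Contractions *)

Lemma forest_contractible (F : wgraph) (e : F) :
  forest F -> wt e = (-1)%R -> deg e <= 2 -> contractible e.
Proof.
move=> forF we de; split=> // u v eu ev uv; apply/negP=> auv.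
have := forF [:: e; u; v]; rewrite /ucycle /= eu auv adjC ev !inE !negb_or.
by rewrite (adj_neq eu) (adj_neq ev) uv => /(_ isT).
Qed.

Definition contract_adj (F : wgraph) (e : F) : rel {x : F | x != e} :=
  fun x y => adj (val x) (val y) ||
    [&& adj e (val x), adj e (val y) & val x != val y].

Lemma contract_adj_sym (F : wgraph) (e : F) : symmetric (@contract_adj F e).
Proof.
by move=> x y; rewrite /contract_adj adjC eq_sym [X in _ || X]andbCA.
Qed.

Lemma contract_adj_irr (F : wgraph) (e : F) : irreflexive (@contract_adj F e).
Proof. by move=> x; rewrite /contract_adj adj_irr eqxx !andbF. Qed.

(** A normal form of the blowing-down at e: it turns the neighbours of e into a clique,
    and is a blowing-down as soon as e is contractible. *)
Definition contract (F : wgraph) (e : F) : wgraph :=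
  @WGraph (Graph (@contract_adj_sym F e) (@contract_adj_irr F e))
    (fun x => if adj e (val x) then (wt (val x) + 1)%R else wt (val x)).

Lemma card_contract (F : wgraph) (e : F) : #|contract e| < #|F|.
Proof.
rewrite card_sig [X in _ < X](cardD1 e) inE add1n ltnS.
by apply/subset_leq_card/subsetP => x; rewrite !inE => ->.
Qed.

Definition nbrs_in_contract (F : wgraph) (e : F) : {set contract e} :=
  [set x | adj e (val x)].

Lemma contract_blowup_along (F : wgraph) (e : F) : contractible e ->
  blowup_along (nbrs_in_contract e) e (val : contract e -> F).
Proof.
case=> we de ne; split.
- split=> [|x]; first exact: val_inj.
  split=> [xe|[y ->]]; last exact: (valP y).
  by exists (Sub x xe : {x : F | x != e}); rewrite SubK.
- by split=> // x; rewrite inE /=; case: (adj e _); rewrite ?addrK.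
- by move=> x; rewrite inE.
- move=> x y; rewrite !inE /= /contract_adj.
  case ex: (adj e (val x)); case ey: (adj e (val y));
    rewrite ?andbT ?orbF ?andbF //=.
  have [->|xy] := eqVneq (val x) (val y); first by rewrite adj_irr.
  by rewrite (negbTE (ne _ _ ex ey xy)).
Qed.

Lemma card_nbrs_in_contract (F : wgraph) (e : F) : contractible e ->
  #|nbrs_in_contract e| = deg e.
Proof. by move/contract_blowup_along/deg_exceptional. Qed.

Lemma clique_nbrs_in_contract (F : wgraph) (e : F) : clique (nbrs_in_contract e).
Proof.
move=> x y; rewrite !inE => ex ey xy.
by apply/orP; right; rewrite ex ey (inj_eq val_inj).
Qed.

Lemma blowup_contract (G F : wgraph) (A : {set G}) (e : F) (i : G -> F) :
  blowup_along A e i -> #|A| <= 2 -> clique A ->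
  contractible e /\ wiso (contract e) G.
Proof.
move=> bl A2 cA; have [[iI ine] [we wi] ae ai] := bl; split.
  split; rewrite ?(deg_exceptional bl) // => u v.
  have [->|[x ->]] := blowup_along_cases u bl; first by rewrite adj_irr.
  have [->|[y ->]] := blowup_along_cases v bl; first by rewrite adj_irr.
  by rewrite !ae ai => -> ->; rewrite andbF.
apply: (@wiso_emb F _ _ (val : contract e -> F) i val_inj iI).
- by move=> x; have /ine[y ->] := valP x; exists y.
- move=> y; have ye : i y != e by apply/ine; exists y.
  by exists (Sub (i y) ye : {x : F | x != e}); rewrite SubK.
- move=> x x' y y' E E'; rewrite /= /contract_adj E E' ai !ae (inj_eq iI).
  have [yA|] := boolP (y \in A); rewrite /= ?andbT ?orbF //.
  have [y'A|] := boolP (y' \in A); rewrite /= ?andbT ?andbF ?orbF //.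
  by have [->|/(cA _ _ yA y'A) ->] := eqVneq y y'; rewrite ?adj_irr.
- by move=> x y E; rewrite /= E ae wi; case: (y \in A); rewrite ?subrK.
Qed.

Lemma blowup_contractP (G F : wgraph) :
  blowup G F -> exists2 e : F, contractible e & wiso (contract e) G.
Proof.
case=> A [e [i [bl /blowup_kindP[A2 cA]]]]; exists e; by have [] := blowup_contract bl A2 cA.
Qed.

Lemma contract_forest (F : wgraph) (e : F) :
  contractible e -> forest F -> forest (contract e).
Proof.
move=> ce /forest_degenerate; move/(blowdown_degenerate (contract_blowup_along ce)).
rewrite card_nbrs_in_contract //; case: ce => _ -> _ /(_ isT).
by move/(_ (@clique_nbrs_in_contract _ _))/degenerate_forest.
Qed.

Lemma forest_blowup (G F : wgraph) : blowup G F -> forest G <-> forest F.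
Proof.
case=> A [e [i [bl /blowup_kindP[A2 cA]]]].
by split=> /forest_degenerate degG; apply: degenerate_forest;
  [exact: blowup_degenerate bl A2 cA degG|exact: blowdown_degenerate bl A2 cA degG].
Qed.

Lemma forest_iso (G H : wgraph) : wiso G H -> forest G -> forest H.
Proof.
by move=> GH /forest_degenerate/(degenerate_iso GH)/degenerate_forest.
Qed.

Lemma contract_iso (F H : wgraph) (phi : F -> H) (e : F) :
  bijective phi -> (forall x y, adj (phi x) (phi y) = adj x y) ->
  (forall x, wt (phi x) = wt x) -> wiso (contract e) (contract (phi e)).
Proof.
move=> [psi K K'] a w; have phiI := can_inj K.
apply: (@wiso_emb H (contract e) (contract (phi e)) (phi \o val) val).
- exact: inj_comp phiI val_inj.
- exact: val_inj.
- move=> x; have Hx : phi (val x) != phi e by rewrite (inj_eq phiI) (valP x).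
  by exists (Sub (phi (val x)) Hx : {y : H | y != phi e}); rewrite SubK.
- move=> y; have Hy : psi (val y) != e.
    by rewrite -(inj_eq phiI) K' (valP y).
  by exists (Sub (psi (val y)) Hy : {x : F | x != e}); rewrite /= K'.
- move=> x x' y y' E E'; rewrite /= /contract_adj -[val y]E -[val y']E' /=.
  by rewrite !a (inj_eq phiI).
- by move=> x y E; rewrite /= -[sval y]E /= a w.
Qed.

(** Nonadjacency matters twice: neither contraction changes the weight of the other
    vertex, nor its neighbours. *)
Lemma contract_comm (F : wgraph) (e e' : F) (p : e' != e) (q : e != e') :
  ~~ adj e e' ->
  wiso (@contract (contract e) (exist _ e' p)) (@contract (contract e') (exist _ e q)).
Proof.
move=> nee'; set a := exist _ e' p; set b := exist _ e q.
apply: (@wiso_emb F (@contract (contract e) a) (@contract (contract e') b)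
  (fun x => val (val x)) (fun x => val (val x))).
- by move=> x y /val_inj/val_inj.
- by move=> x y /val_inj/val_inj.
- move=> x; have H1 : val (val x) != e' := valP x.
  have H2 : (Sub (val (val x)) H1 : {x : F | x != e'}) != b.
    by rewrite -(inj_eq val_inj) SubK; exact: (valP (val x)).
  by exists (Sub (Sub (val (val x)) H1 : {x : F | x != e'}) H2
    : {x : contract e' | x != b}); rewrite !SubK.
- move=> x; have H1 : val (val x) != e := valP x.
  have H2 : (Sub (val (val x)) H1 : {x : F | x != e}) != a.
    by rewrite -(inj_eq val_inj) SubK; exact: (valP (val x)).
  by exists (Sub (Sub (val (val x)) H1 : {x : F | x != e}) H2
    : {x : contract e | x != a}); rewrite !SubK.
- move=> x x' y y' E E'; rewrite /= /contract_adj /= /contract_adj /=.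
  rewrite -!(inj_eq val_inj) /= E E' (adjC e' e) (negbTE nee') /= !orbF.
  by rewrite -!orbA; congr (_ || _); rewrite orbC.
- move=> x y E; rewrite /= /contract_adj /= E (adjC e' e) (negbTE nee') /= !orbF.
  by case: (adj e _); case: (adj e' _).
Qed.

Lemma contractible_contract (F : wgraph) (e : F) (y : contract e) :
  forest F -> contractible e -> ~~ adj e (val y) ->
  contractible y <-> contractible (val y).
Proof.
move=> forF ce ney; have bl := contract_blowup_along ce.
have dy : deg (val y) = deg y by apply: (deg_blowup_notin bl); rewrite inE.
have wy : wt y = wt (val y) by rewrite /= (negbTE ney).
split=> -[w d _].
  by apply: (forest_contractible forF); rewrite -?wy ?dy.
by apply: (forest_contractible (contract_forest ce forF)); rewrite ?wy -?dy.
Qed.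

Lemma minimal_or_contractible (F : wgraph) :
  forest F -> minimal_graph F \/ exists e : F, contractible e.
Proof.
move=> forF; case: (pickP (fun e : F => (wt e == (-1)%R) && (deg e <= 2))) => [e|no].
  by case/andP=> /eqP we de; right; exists e; apply: forest_contractible.
by left=> e [we de _]; have := no e; rewrite we eqxx de.
Qed.

(** * Equivalent minimal forests are strictly equivalent *)

Definition strict_blowup (G F : wgraph) : Prop :=
  exists (e : F) (i : G -> F), strict_blowup_at e i.

Definition strict_equiv : wgraph -> wgraph -> Prop :=
  clos_refl_sym_trans _ (fun G F => strict_blowup G F \/ wiso G F).

(** If e has degree 1, its neighbour u loses it and ends with degree at most 1; if e has
    degree 2, the blowing-up is subdivisional. *)
Lemma strict_contract (F : wgraph) (e u : F) :
  contractible e -> adj e u -> deg u <= 2 -> strict_blowup (contract e) F.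
Proof.
move=> ce eu du; have bl := contract_blowup_along ce.
exists e, val, (nbrs_in_contract e); split=> //.
have ue : u != e by rewrite eq_sym adj_neq.
pose u' : contract e := Sub u ue.
have u'A : u' \in nbrs_in_contract e by rewrite inE SubK.
have : #|nbrs_in_contract e| <= 2 by rewrite card_nbrs_in_contract //; case: ce.
case E: #|nbrs_in_contract e| => [|[|[|//]]] _.
- by move/eqP: E u'A; rewrite cards_eq0 => /eqP ->; rewrite inE.
- move/eqP/cards1P: E => [v E]; right; exists v; split=> //.
  move: u'A; rewrite E => /set1P uv; rewrite E -uv in bl.
  by rewrite -uv -ltnS -(deg_blowup_vertex bl).
- have [v [E' _ uv]] := clique2P E (@clique_nbrs_in_contract _ _) u'A.
  by left; exists u', v.
Qed.

Inductive reduces : wgraph -> wgraph -> Prop :=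
| ReducesIso (F G : wgraph) : wiso F G -> reduces F G
| ReducesStep (F : wgraph) (e : F) (G : wgraph) :
    contractible e -> reduces (contract e) G -> reduces F G.

Lemma iso_reduces (F F' G : wgraph) : wiso F F' -> reduces F' G -> reduces F G.
Proof.
move=> FF' r; elim: r F FF' => [{}F' {}G F'G F FF'|{}F' e {}G ce _ IH F].
  exact/ReducesIso/(wiso_trans FF').
case/wiso_sym=> psi [bpsi a w].
apply: (@ReducesStep F (psi e)); first exact: contractible_iso.
by apply: IH; apply/wiso_sym/contract_iso.
Qed.

Lemma minimal_reduces (F G : wgraph) : minimal_graph F -> reduces F G -> wiso F G.
Proof. by move=> minF r; case: r minF => // {}F e {}G ce _ /(_ e). Qed.

Lemma reduces_minimal (F : wgraph) : forest F ->
  exists2 K, reduces F K & minimal_graph K.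
Proof.
have [n] := ubnP #|F|; elim: n F => // n IH F; rewrite ltnS => ltn forF.
have [minF|[e ce]] := minimal_or_contractible forF.
  by exists F => //; apply/ReducesIso/wiso_refl.
have [|K r minK] := IH (contract e) _ (contract_forest ce forF).
  exact: leq_trans (card_contract e) ltn.
by exists K => //; apply: ReducesStep r.
Qed.

(** The hypotheses on z survive the contraction of a contractible vertex x: it is adjacent
    to z, so the weight of z grows and its degree does not; the other neighbour of x becomes
    adjacent to z; and the remaining vertices are contractible only if they were so before.  By
    [strict_contract] with u equal to z, the contraction is strict. *)
Lemma reduces_strictly (F : wgraph) (z : F) : forest F ->
  (0 <= wt z)%R -> deg z <= 2 -> (forall x : F, contractible x -> adj z x) ->
  exists K, [/\ reduces F K, minimal_graph K & strict_equiv K F].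
Proof.
have [n] := ubnP #|F|; elim: n F z => // n IH F z; rewrite ltnS => ltn forF wz dz Hz.
have [minF|[x cx]] := minimal_or_contractible forF.
  by exists F; split=> //; [apply/ReducesIso/wiso_refl|apply: rst_refl].
have zx := Hz x cx; have bl := contract_blowup_along cx.
have dA : #|nbrs_in_contract x| <= 2 by rewrite card_nbrs_in_contract //; case: cx.
pose z' : contract x := Sub z (adj_neq zx).
have [||||y cy|K [r minK sK]] := IH (contract x) z'.
- exact: leq_trans (card_contract x) ltn.
- exact: contract_forest.
- by rewrite /= adjC zx ler_wpDr.
- apply: leq_trans dz; apply: (deg_blowup_ge _ bl) => //.
  exact: clique_nbrs_in_contract.
- have yz : y != z'.
    apply: contraTneq isT => yz; case: cy => + _ _; rewrite yz /= adjC zx => E.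
    by have : (0 <= wt z + 1)%R; [rewrite ler_wpDr|rewrite E].
  have [xy|xy] := boolP (adj x (val y)).
    by apply: clique_nbrs_in_contract; rewrite ?inE ?SubK // 1?adjC // eq_sym.
  by move/(contractible_contract forF cx xy)/Hz: cy => zy; rewrite /= /contract_adj zy.
exists K; split=> //; first exact: ReducesStep r.
apply: rst_trans sK _; apply: rst_step; left.
by apply: strict_contract dz; rewrite // adjC.
Qed.

Definition confluent (F : wgraph) : Prop := forall G H,
  reduces F G -> minimal_graph G -> reduces F H -> minimal_graph H ->
  strict_equiv G H.

(** G and H are compared with a minimal forest K obtained by contracting at both e and
    e', in either order. *)
Lemma confluent_nonadj (F : wgraph) (e e' : F) (G H : wgraph) : forest F ->
  (forall F' : wgraph, #|F'| < #|F| -> forest F' -> confluent F') ->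
  contractible e -> contractible e' -> e != e' -> ~~ adj e e' ->
  reduces (contract e) G -> minimal_graph G ->
  reduces (contract e') H -> minimal_graph H -> strict_equiv G H.
Proof.
move=> forF IH ce ce' ee' nee' rG mG rH mH.
have e'e : e' != e by rewrite eq_sym.
pose a : contract e := Sub e' e'e; pose b : contract e' := Sub e ee'.
have ca : contractible a by apply/contractible_contract; rewrite ?SubK.
have cb : contractible b by apply/contractible_contract; rewrite ?SubK // adjC.
have fe := contract_forest ce forF; have fe' := contract_forest ce' forF.
have [K rK mK] := reduces_minimal (contract_forest ca fe).
apply: (@rst_trans _ _ _ K).
  by apply: (IH (contract e)) => //; [exact: card_contract|exact: ReducesStep rK].
apply: (IH (contract e')) => //; first exact: card_contract.
apply: (ReducesStep cb); apply: iso_reduces rK; apply: wiso_sym.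
exact: contract_comm.
Qed.

(** After the contraction of e, the vertex e' has weight 0 and satisfies the hypotheses of
    [reduces_strictly]: a vertex contractible only after the contraction was a neighbour of e, and
    becomes a neighbour of e'. *)
Lemma confluent_adj (F : wgraph) (e e' : F) : forest F ->
  contractible e -> contractible e' -> adj e e' ->
  (forall x : F, contractible x -> x != e -> x != e' -> adj e x || adj e' x) ->
  exists K, [/\ reduces (contract e) K, minimal_graph K & strict_equiv K F].
Proof.
move=> forF ce ce' ee' Hx; have bl := contract_blowup_along ce.
have e'e : e' != e by rewrite eq_sym adj_neq.
case: (ce) => _ de _; case: (ce') => we' de' _.
have [|||x cx|K [r minK sK]] := @reduces_strictly (contract e) (Sub e' e'e).
- exact: contract_forest.
- by rewrite /= ee' we'.
- apply: leq_trans de'; apply: (deg_blowup_ge _ bl).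
    by rewrite card_nbrs_in_contract.
  exact: clique_nbrs_in_contract.
- have xe' : val x != e'.
    by case: cx => + _ _; apply: contra_eqN => /eqP E; rewrite /= E ee' we'.
  have [ex|ex] := boolP (adj e (val x)).
    by apply: clique_nbrs_in_contract; rewrite ?inE ?SubK // -(inj_eq val_inj) eq_sym.
  have := Hx (val x) ((contractible_contract forF ce ex).1 cx) (valP x) xe'.
  by rewrite (negbTE ex) /= /contract_adj /= => ->.
exists K; split=> //; apply: rst_trans sK _; apply: rst_step; left.
exact: strict_contract ce ee' de'.
Qed.

Lemma reducesP (F G : wgraph) : reduces F G ->
  wiso F G \/ exists2 e : F, contractible e & reduces (contract e) G.
Proof. by case=> [{}F {}G|{}F e {}G]; [left|right; exists e]. Qed.

(** By induction on the number of vertices; the only case beyond [confluent_nonadj] is that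
    of adjacent e and e' such that every contractible vertex is adjacent to one of them, and there
    F itself links the two sides strictly by [confluent_adj]. *)
Theorem forest_confluent (F : wgraph) : forest F -> confluent F.
Proof.
have [n] := ubnP #|F|; elim: n F => // n IHn F; rewrite ltnS => ltn forF.
have IH (F' : wgraph) : #|F'| < #|F| -> forest F' -> confluent F'.
  by move=> lt; apply: IHn; apply: leq_trans ltn.
move=> G H rG mG rH mH.
have [FG|[e ce rG']] := reducesP rG.
  have mF := minimal_iso (wiso_sym FG) mG.
  apply: rst_step; right; apply: wiso_trans (wiso_sym FG) _.
  exact: minimal_reduces.
have [FH|[e' ce' rH']] := reducesP rH.
  by case: (minimal_iso (wiso_sym FH) mH ce).
have [E|ee'] := eqVneq e e'.
  subst e'; apply: (IH (contract e)) => //; first exact: card_contract.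
  exact: contract_forest.
have [aee'|nee'] := boolP (adj e e'); last exact: (confluent_nonadj forF IH ce ce').
(* A contractible x adjacent to neither e nor e' links the two contractions. *)
case: (pickP (fun x : F => [&& wt x == (-1)%R, deg x <= 2, x != e, x != e'
    & ~~ (adj e x || adj e' x)])) => [x|no].
  case/and5P=> /eqP wx dx xe xe'; rewrite negb_or => /andP[ex e'x].
  have cx := forest_contractible forF wx dx.
  have [K rK mK] := reduces_minimal (contract_forest cx forF).
  apply: (@rst_trans _ _ _ K).
    by apply: (confluent_nonadj forF IH ce cx) => //; rewrite eq_sym.
  by apply: (confluent_nonadj forF IH cx ce') => //; rewrite adjC.
have Hx (x : F) : contractible x -> x != e -> x != e' -> adj e x || adj e' x.
  case=> wx dx _ xe xe'; have := no x.
  by rewrite wx eqxx dx xe xe' /= => /negbFE.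
have [K [rK mK sK]] := confluent_adj forF ce ce' aee' Hx.
have [||K' [rK' mK' sK']] := confluent_adj forF ce' ce.
- by rewrite adjC.
- by move=> x cx xe' xe; rewrite orbC Hx.
apply: (@rst_trans _ _ _ K).
  apply: (IH (contract e)) => //; [exact: card_contract|exact: contract_forest].
apply: rst_trans sK _; apply: rst_trans (rst_sym _ _ _ _ sK') _.
apply: (IH (contract e')) => //; [exact: card_contract|exact: contract_forest].
Qed.

Lemma wequiv_forest (G H : wgraph) : wequiv G H -> forest G <-> forest H.
Proof.
elim=> [A B /forest_blowup//|A //|A B _ [? ?]|A B D _ [H1 H2] _ [H3 H4]].
  by split.
by split=> [/H1/H3|/H4/H2].
Qed.

(** If B is a blowing-up of A, the minimal forests to which A contracts are among those to
    which B contracts, so [forest_confluent] propagates along the equivalence. *)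
Theorem minimal_wequiv_strict_equiv (G H : wgraph) : forest G ->
  minimal_graph G -> minimal_graph H -> wequiv G H -> strict_equiv G H.
Proof.
move=> forG mG mH GH.
suff all_eq (A B : wgraph) : wequiv A B -> forest A -> forall K L,
    reduces A K -> minimal_graph K -> reduces B L -> minimal_graph L -> strict_equiv K L.
  by apply: (all_eq G H) => //; apply/ReducesIso/wiso_refl.
elim=> {A B G H forG mG mH GH} [A B AB forA K L rK mK rL mL|A forA|A B AB IH forB|].
- have [e ce eA] := blowup_contractP AB.
  apply: (@forest_confluent B) => //; first exact/(forest_blowup AB).
  apply: (ReducesStep ce); exact: iso_reduces eA rK.
- exact: forest_confluent.
- move=> K L rK mK rL mL; apply: rst_sym; apply: IH => //.
  exact/(wequiv_forest AB).
- move=> A B D AB IH1 BD IH2 forA K L rK mK rL mL.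
  have forB := (wequiv_forest AB).1 forA.
  have [M rM mM] := reduces_minimal forB.
  by apply: (@rst_trans _ _ _ M); [exact: IH1|exact: IH2].
Qed.

(** * Skeletal maps *)

Lemma src_svec (G G' : graph) (f : skelmap G G') g : src (svec f g) = f (src g).
Proof. by have /andP[/eqP ->] := xchooseP (sk_path f g). Qed.

Lemma tgt_svec (G G' : graph) (f : skelmap G G') g : tgt (svec f g) = f (tgt g).
Proof. by have /andP[_ /eqP ->] := xchooseP (sk_path f g). Qed.

Lemma svec_unique (G G' : graph) (f : skelmap G G') g g' : forest G' ->
  src g' = f (src g) -> tgt g' = f (tgt g) -> svec f g = g'.
Proof. by move=> forG' sg tg; apply: epath_unique; rewrite // ?src_svec ?tgt_svec. Qed.

Lemma skelmap_exists (G G' : graph) (f : core G -> core G') : forest G' ->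
  (forall g, exists g', src g' = f (src g) /\ tgt g' = f (tgt g)) ->
  (forall g', exists g, src g' = f (src g) /\ tgt g' = f (tgt g)) ->
  (forall u v, u != v -> f u = f v -> exists g, src g = u /\ tgt g = v) ->
  exists s : skelmap G G', forall x, s x = f x.
Proof.
move=> forG' fp fs fi.
have sp g : exists g', ends_match f g g'.
  by have [g' [sg tg]] := fp g; exists g'; rewrite /ends_match sg tg !eqxx.
suff ss g' : exists g, vec sp g = g' by exists (SkelMap ss fi).
have [g [sg tg]] := fs g'; exists g.
by have /andP[/eqP a /eqP b] := xchooseP (sp g); apply: epath_unique; rewrite // -?a -?b.
Qed.

Lemma core_src (G : graph) (x : core G) : forest G -> exists g : epath G, src g = x.
Proof.
move=> forG; have [d0|/deg_gt0P[y xy]] := posnP (deg (val x)).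
  have [g E] := epath_of_spec (EpathPoint (erefl [:: val x]) d0).
  by exists g; apply: val_inj; rewrite (src_pseq E).
have [g [p E]] := edge_epath forG (valP x) xy.
by exists g; apply: val_inj; rewrite (src_pseq E).
Qed.

Lemma skelmap_onto (G G' : graph) (f : skelmap G G') : forest G' ->
  forall y, exists x, f x = y.
Proof.
move=> forG' y; have [g' sg'] := core_src y forG'.
by have [g E] := sk_surj f g'; exists (src g); rewrite -src_svec -sg' -E.
Qed.

Lemma src_neq_tgt_deg (G : graph) (g : epath G) :
  (src g != tgt g) = (0 < deg (val (src g))).
Proof.
apply/idP/idP => [|d]; last first.
  by apply: contraTneq d => /src_tgt_deg0 ->.
rewrite lt0n; apply: contra_neq => /src_deg0_tgt E.
by apply: val_inj; rewrite (tgt_pseq E).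
Qed.

(** A path joining x and y must be sent to a path whose ends coincide, that is, to an
    isolated vertex. *)
Lemma fibre_deg (G G' : graph) (f : skelmap G G') (x y : core G) :
  x != y -> f x = f y ->
  [/\ deg (val (f x)) = 0, 0 < deg (val x) & 0 < deg (val y)].
Proof.
move=> xy fxy; have [g [sg tg]] := sk_inj xy fxy.
split.
- by rewrite -sg -src_svec; apply: src_tgt_deg0; rewrite src_svec tgt_svec sg tg.
- by rewrite -sg -src_neq_tgt_deg sg tg.
- by rewrite -tg -src_rev -src_neq_tgt_deg src_rev tgt_rev sg tg eq_sym.
Qed.

(** Three elements of a fibre would be joined pairwise by paths, forming a triangle. *)
Lemma fibre_le2 (G G' : graph) (f : skelmap G G') (x y z : core G) : forest G ->
  f x = f y -> f x = f z -> [|| x == y, y == z | z == x].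
Proof.
move=> forG xy xz; apply/negPn/negP; rewrite !negb_or => /and3P[nxy nyz nzx].
have [g1 [s1 t1]] := sk_inj nxy xy.
have [g2 [s2 t2]] := sk_inj nyz (etrans (esym xy) xz).
have [g3 [s3 t3]] := sk_inj nzx (esym xz).
by apply: (@no_epath_triangle _ g1 g2 g3); rewrite ?s1 ?s2 ?s3 ?t1 ?t2 ?t3.
Qed.

Lemma skelmap_comp (S G G' : graph) (f : skelmap S G) (f' : skelmap G G') :
  forest G' -> exists s : skelmap S G', forall x, s x = f' (f x).
Proof.
move=> forG'; apply: (skelmap_exists (f := fun x => f' (f x))) => //.
- by move=> g; exists (svec f' (svec f g)); rewrite !src_svec !tgt_svec.
- move=> g'; have [g1 E] := sk_surj f' g'; have [g E1] := sk_surj f g1.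
  exists g; rewrite -src_svec -tgt_svec -[svec f g]/(vec _ g) E1.
  by rewrite -src_svec -tgt_svec -[svec f' g1]/(vec _ g1) E.
- move=> u v uv E; have [E'|nE] := eqVneq (f u) (f v); first exact: (sk_inj uv E').
  have [h [sh th]] := sk_inj nE E; have [g Eg] := sk_surj f h.
  have dh : 0 < deg (val (f u)) by rewrite -sh -src_neq_tgt_deg sh th.
  have dh' : 0 < deg (val (f v)).
    by rewrite -th -src_rev -src_neq_tgt_deg src_rev tgt_rev sh th eq_sym.
  have Eg' : svec f g = h by [].
  exists g; split; apply/eqP/negPn/negP => n.
    have Es : f (src g) = f u by rewrite -src_svec Eg' sh.
    by have [d _ _] := fibre_deg n Es; move: dh; rewrite -Es d.
  have Et : f (tgt g) = f v by rewrite -tgt_svec Eg' th.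
  by have [d _ _] := fibre_deg n Et; move: dh'; rewrite -Et d.
Qed.

(** If the sources of g and h differ, their common image is isolated; all four ends then
    lie in one fibre, and as it has at most two elements, h runs from the target of g to its
    source. *)
Lemma epath_fibre (G G' : graph) (f : skelmap G G') (g h : epath G) : forest G ->
  f (src g) = f (src h) -> f (tgt g) = f (tgt h) -> h = g \/ h = rev_epath g.
Proof.
move=> forG Es Et.
have swap (g' h' : epath G) : f (src g') = f (src h') -> f (tgt g') = f (tgt h') ->
    src g' != src h' -> h' = rev_epath g'.
  move=> Es' Et' n; have [d dg dh] := fibre_deg n Es'.
  have fg : f (src g') = f (tgt g').
    apply/eqP; move: (src_neq_tgt_deg (svec f g')).
    by rewrite src_svec tgt_svec d => /negbFE.
  rewrite -src_neq_tgt_deg in dg; rewrite -src_neq_tgt_deg in dh.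
  apply: epath_unique => //; rewrite ?src_rev ?tgt_rev.
    have := fibre_le2 forG Es' fg.
    by rewrite (negbTE n) (eq_sym (tgt g')) (negbTE dg) orbF => /eqP.
  have := fibre_le2 forG (esym Es') (etrans (esym Es') (etrans fg Et')).
  rewrite eq_sym (negbTE n) (eq_sym (tgt h')) (negbTE dh) orbF.
  by move/eqP.
have [s|s] := eqVneq (src g) (src h); last by right; apply: swap.
have [t|t] := eqVneq (tgt g) (tgt h); first by left; apply: epath_unique.
right; rewrite -[g]rev_epathK -[h]rev_epathK; congr rev_epath.
by apply: swap; rewrite ?src_rev ?tgt_rev.
Qed.

(** Over a vertex of positive degree the fibre of f is a single element and there is no
    choice.  Over an isolated vertex the fibre of s has exactly two elements, since the paths of
    S have distinct ends; one is sent to one preimage, the other to the second preimage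
    if there is one. *)
Lemma skelmap_lift (S G1 G : graph) (f : skelmap G1 G) (s : skelmap S G) :
  forest S -> (forall v : S, deg v <> 0) -> forest G1 -> forest G ->
  exists s1 : skelmap S G1, forall x, f (s1 x) = s x.
Proof.
move=> forS S0 forG1 forG.
have onto y : exists x, f x == y.
  by have [x <-] := skelmap_onto f forG y; exists x.
(* x0 y and x1 y exhaust the fibre over y; they agree when it is a singleton. *)
pose x0 y := xchoose (onto y).
have fx0 y : f (x0 y) = y by apply/eqP/(xchooseP (onto y)).
pose x1 y := odflt (x0 y) [pick x | (f x == y) && (x != x0 y)].
have fx1 y : f (x1 y) = y.
  by rewrite /x1; case: pickP => [x /andP[/eqP]|_] //=.
pose s1 u := if [pick v | s v == s u] == Some u then x0 (s u) else x1 (s u).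
have fs1 u : f (s1 u) = s u by rewrite /s1; case: ifP.
have src_tgt (g : epath S) : src g != tgt g.
  by rewrite src_neq_tgt_deg lt0n; apply/eqP/S0.
have pathP g : exists g1, src g1 = s1 (src g) /\ tgt g1 = s1 (tgt g).
  have [g1 E] := sk_surj f (svec s g); rewrite -[vec _ _]/(svec f g1) in E.
  have Es : f (src g1) = s (src g) by rewrite -!src_svec E.
  have Et : f (tgt g1) = s (tgt g) by rewrite -!tgt_svec E.
  have [eq_s|neq_s] := eqVneq (s (src g)) (s (tgt g)); last first.
    have d (g' : epath G) : src g' != tgt g' -> deg (val (src g')) <> 0.
      by rewrite src_neq_tgt_deg lt0n => /eqP.
    exists g1; split; apply/eqP/negPn/negP => n.
      have [|d0 _ _] := @fibre_deg _ _ f _ _ n; first by rewrite fs1.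
      by apply: (d (svec s g)); rewrite ?src_svec ?tgt_svec // -Es.
    have [|d0 _ _] := @fibre_deg _ _ f _ _ n; first by rewrite fs1.
    apply: (d (rev_epath (svec s g))); rewrite ?src_rev ?tgt_rev ?src_svec ?tgt_svec.
      by rewrite eq_sym.
    by rewrite -Et.
  have onto_pair : exists h, src h = x0 (s (src g)) /\ tgt h = x1 (s (src g)).
    rewrite /x1; case: pickP => [x /andP[/eqP fx nx]|no] /=.
      by apply: (@sk_inj _ _ f); rewrite 1?eq_sym ?fx0.
    have x0E x : f x = s (src g) -> x = x0 (s (src g)).
      by move=> fx; have := no x; rewrite fx eqxx /= => /negbFE/eqP.
    by exists g1; split; apply: x0E; rewrite // Et.
  case: onto_pair => h [sh th]; rewrite /s1 -eq_s.
  case: pickP => [t /eqP st|/(_ (src g))]; last by rewrite eqxx.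
  have := fibre_le2 forS eq_s (esym st); rewrite (negbTE (src_tgt g)) /=.
  rewrite (inj_eq Some_inj) (inj_eq Some_inj) => /orP[]/eqP tE.
    rewrite -tE eqxx eq_sym (negbTE (src_tgt g)).
    by exists (rev_epath h); rewrite src_rev tgt_rev.
  by rewrite tE eqxx (negbTE (src_tgt g)); exists h.
have [g1|u v uv E|s1' s1E] := @skelmap_exists S G1 s1 forG1 pathP.
- have [g E] := sk_surj s (svec f g1); have E' : svec s g = svec f g1 by [].
  have [h [sh th]] := pathP g.
  have [||->|->] := @epath_fibre _ _ f h g1 forG1.
  + by rewrite sh fs1 -!src_svec E'.
  + by rewrite th fs1 -!tgt_svec E'.
  + by exists g.
  + by exists (rev_epath g); rewrite !src_rev !tgt_rev.
- by apply: (@sk_inj _ _ s _ _ uv); rewrite -!fs1 E.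
- by exists s1' => u; rewrite s1E.
Qed.

(** * Paths under a strict blowing-up *)

Definition weights (G : wgraph) (s : seq G) : seq int :=
  [seq wt v | v <- s & deg v < 3].

Lemma weights_cat (G : wgraph) (s t : seq G) :
  weights (s ++ t) = weights s ++ weights t.
Proof. by rewrite /weights filter_cat map_cat. Qed.

Lemma Wt_rev (G : wgraph) (g : epath G) : Wt (rev_epath g) = rev (Wt g).
Proof. by rewrite /Wt pseq_rev_epath filter_rev map_rev. Qed.

(** A vertex inside the path has degree 2 and both neighbours on it; a source or target
    of degree less than 3 has degree at most 1, as it cannot be 2. *)
Lemma epath_nbrs (G : graph) (g : epath G) (z u : G) :
  z \in pseq g -> deg z < 3 -> adj z u -> u \in pseq g.
Proof.
have ends (h : epath G) : deg (val (src h)) < 3 -> adj (val (src h)) u -> u \in pseq h.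
  move=> d su; have [p] := pseq_cons h; case: p => [|x p] E.
    have d0 : deg (val (src h)) = 0.
      by apply: src_tgt_deg0; apply: val_inj; rewrite (tgt_pseq E).
    have : 0 < deg (val (src h)) by apply/deg_gt0P; exists u.
    by rewrite d0.
  rewrite E !inE; have [->|xu] := eqVneq u x; first by rewrite orbT.
  have d1 : deg (val (src h)) < 2 by rewrite ltn_neqAle (valP (src h)) -ltnS.
  have sx : adj (val (src h)) x.
    by move/epath_straight: E; case/and4P=> _ /andP[].
  have := @size_nbrs_le_deg _ (val (src h)) [:: u; x].
  by rewrite /= inE xu su sx => /(_ isT isT); rewrite leqNgt d1.
case: (epathP g) => [v s dv|v m w s U P dv dw dm] zg dz zu.
  have Ez : z = val (src g) by rewrite (src_pseq s); move: zg; rewrite s inE => /eqP.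
  by apply: ends; rewrite -Ez.
have /or3P : [|| z == v, z == w | z \in m] by move: zg; rewrite s in_cons mem_rcons in_cons.
case=> [/eqP zv|/eqP zw|zm].
- by apply: ends; rewrite (src_pseq s) -zv.
- rewrite -mem_rev -pseq_rev_epath.
  by apply: ends; rewrite src_rev (tgt_pseq s) last_rcons -zw.
rewrite s in U *; have [a [b [am bm za zb ab]]] := interior_nbrs U P zm.
apply/negPn/negP => um.
have := @size_nbrs_le_deg _ z [:: u; a; b]; rewrite (eqP (allP dm z zm)).
rewrite /= zu za zb !inE ab negb_or.
have -> : u != a by apply: contraNneq um => ->.
have -> : u != b by apply: contraNneq um => ->.
by move=> /(_ isT isT).
Qed.

Lemma epath_spec_map (G G' : graph) (f : G -> G') (s : seq G) : injective f ->
  {in s, forall x, deg (f x) = deg x} ->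
  (forall x y, adj (f x) (f y) -> adj x y) ->
  epath_spec (map f s) -> epath_spec s.
Proof.
move=> fI fd fa; case=> [v|v m w].
  case: s fd => [|x [|y s]] //= fd [fx] dv.
  by apply: (EpathPoint (erefl _)); rewrite -fd ?mem_head // fx.
case: s fd => [|x s] //; case/lastP: s => [|s y] fd; first by case=> _; case: m.
rewrite map_cons map_rcons => -[<- /rcons_inj[<- <-]] U P dx dy ds.
apply: (EpathLong (erefl _)).
- by rewrite -(map_inj_uniq fI) /= map_rcons.
- by move: P; rewrite -map_rcons path_map; apply: sub_path => a b; apply: fa.
- by rewrite -fd ?mem_head.
- by rewrite -fd // inE mem_rcons mem_head orbT.
- apply/allP => a am; move: ds; rewrite all_map => /allP/(_ a am).
  by rewrite /deg2 /= fd // inE mem_rcons inE am !orbT.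
Qed.

Definition strict_along (G F : wgraph) (A : {set G}) (e : F) (i : G -> F) : Prop :=
  blowup_along A e i /\
  (#|A| = 2 /\ clique A \/ exists v, A = [set v] /\ deg v <= 1).

Lemma strict_blowup_along (G F : wgraph) (e : F) (i : G -> F) :
  strict_blowup_at e i -> exists A, strict_along A e i.
Proof.
case=> A [bl H]; exists A; split=> //.
case: H => [[v1 [v2 v12]]|]; [left|by case=> v [? ?]; right; exists v].
have /blowup_kindP[_ cA] : [\/ exists v, at_vertex v A,
  exists v1 v2, at_edge v1 v2 A | Defs.free A] by apply: Or32; exists v1, v2.
by split=> //; case: v12 => a ->; rewrite cards2 adj_neq.
Qed.

Lemma seq_preimage (G F : wgraph) (A : {set G}) (e : F) (i : G -> F) (l : seq F) :
  blowup_along A e i -> e \notin l -> exists s, l = map i s.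
Proof.
move=> bl; elim: l => [|z l IH]; first by exists [::].
rewrite inE negb_or => /andP[ez /IH[s ->]].
have [ze|[x ->]] := blowup_along_cases z bl; first by rewrite ze eqxx in ez.
by exists (x :: s).
Qed.

Lemma filter_exceptional (G F : wgraph) (A : {set G}) (e : F) (i : G -> F) s :
  blowup_along A e i -> [seq z <- map i s | z != e] = map i s.
Proof.
case=> -[_ ine] _ _ _; apply/all_filterP; rewrite all_map.
by apply/allP => x _ /=; apply/ine; exists x.
Qed.

Lemma weights_map (G F : wgraph) (A : {set G}) (e : F) (i : G -> F) s :
  blowup_along A e i -> {in s, forall x, deg (i x) = deg x} ->
  {in s, forall x, deg x < 3 -> x \notin A} ->
  weights (map i s) = weights s.
Proof.
move=> [_ [_ wi] _ _]; elim: s => [|x s IH] //= ds As.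
rewrite /weights /= ds ?mem_head //; case: ifP => [d3|_] /=.
  rewrite wi (negbTE (As x (mem_head _ _) d3)); congr (_ :: _).
  by apply: IH => z zs; [apply: ds|apply: As]; rewrite inE zs orbT.
by apply: IH => z zs; [apply: ds|apply: As]; rewrite inE zs orbT.
Qed.

Lemma weights_map_cons (G F : wgraph) (A : {set G}) (e : F) (i : G -> F) x s :
  blowup_along A e i -> {in x :: s, forall z, deg (i z) = deg z} ->
  {in s, forall z, z \notin A} -> x \in A -> (deg x < 3) || (s == [::]) ->
  inc_head (weights (map i (x :: s))) = weights (x :: s).
Proof.
move=> bl ds As xA; have [_ [_ wi] _ _] := bl.
rewrite /weights /= ds ?mem_head //; case: ifP => [d3 _|_ /eqP->] //=.
rewrite wi xA subrK; congr (_ :: _).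
by apply: (weights_map bl) => z zs; rewrite ?As // ds // inE zs orbT.
Qed.

Lemma weights_map_rcons (G F : wgraph) (A : {set G}) (e : F) (i : G -> F) x s :
  blowup_along A e i -> {in rcons s x, forall z, deg (i z) = deg z} ->
  {in s, forall z, z \notin A} -> x \in A -> (deg x < 3) || (s == [::]) ->
  inc_last (weights (map i (rcons s x))) = weights (rcons s x).
Proof.
move=> bl ds As xA H.
have wrev (K : wgraph) (t : seq K) : weights t = rev (weights (rev t)).
  by rewrite /weights filter_rev map_rev revK.
rewrite wrev [RHS]wrev -map_rev rev_rcons /inc_last revK; congr rev.
apply: (weights_map_cons bl) => //.
- by move=> z; rewrite inE mem_rev -in_cons -mem_rcons; apply: ds.
- by move=> z; rewrite mem_rev; apply: As.
- by rewrite -size_eq0 size_rev size_eq0.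
Qed.

(** The image of g1 under the blowing-down map, described through its vertices. *)
Definition lies_over (G F : wgraph) (e : F) (i : G -> F) (g1 : epath F) (g : epath G) :=
  map i (pseq g) = [seq z <- pseq g1 | z != e].

Lemma lies_over_rev (G F : wgraph) (e : F) (i : G -> F) (g1 : epath F) (g : epath G) :
  lies_over e i g1 g -> lies_over e i (rev_epath g1) (rev_epath g).
Proof. by rewrite /lies_over !pseq_rev_epath map_rev filter_rev => ->. Qed.

(** Vertices of A of degree less than 3 on the path would bring e onto it, by
    [epath_nbrs]; so the path meets A at most in vertices whose weights are not recorded. *)
Lemma epath_down_avoid (G F : wgraph) (A : {set G}) (e : F) (i : G -> F) (g1 : epath F) :
  strict_along A e i -> e \notin pseq g1 ->
  exists g, lies_over e i g1 g /\ seq_equiv (Wt g1) (Wt g).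
Proof.
case=> bl st eg1; have [[iI ine] _ ae ai] := bl.
have [s E] := seq_preimage bl eg1.
have As x : x \in s -> deg (i x) < 3 -> x \notin A.
  move=> xs d; apply: contra eg1 => xA.
  apply: (@epath_nbrs _ g1 (i x)); rewrite ?E ?mem_map //.
  by rewrite adjC ae.
have ds : {in s, forall x, deg (i x) = deg x}.
  move=> x xs; case: st => [[A2 cA]|[v [EA dv]]].
    exact: deg_blowup_edge bl cA A2.
  apply: (deg_blowup_notin bl); apply/negP=> xA; move: (As x xs).
  rewrite xA; move: xA bl; rewrite EA => /set1P-> bl.
  by rewrite (deg_blowup_vertex bl) !ltnS dv => /(_ isT).
have [|g sg] := @epath_of_spec G s.
  apply: (epath_spec_map iI ds); last by rewrite -E; apply: epathP.
  by move=> x y; rewrite ai => /andP[].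
exists g; split; first by rewrite /lies_over sg E (filter_exceptional _ bl).
rewrite /Wt -!/(weights _) sg E (weights_map bl ds); first exact: rst_refl.
by move=> x xs; rewrite -ds //; apply: As.
Qed.

(** Here e lies between the two elements of A, and its removal contracts the weight
    sequence.  An element of A of degree at least 3 is an end of the path and is not recorded; this
    is where the four kinds of blowing-up of a sequence come from. *)
Lemma epath_down_edge (G F : wgraph) (A : {set G}) (e : F) (i : G -> F) (g1 : epath F) :
  blowup_along A e i -> #|A| = 2 -> clique A -> e \in pseq g1 ->
  exists g, lies_over e i g1 g /\ seq_equiv (Wt g1) (Wt g).
Proof.
move=> bl A2 cA eg1; have [[iI ine] [we wi] ae ai] := bl.
have de : deg e = 2 by rewrite (deg_exceptional bl).
have di x : deg (i x) = deg x by apply: deg_blowup_edge bl cA A2.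
case: (epathP g1) eg1 => [v s dv|v m w s U P dv dw dm]; rewrite {1}s.
  by rewrite inE => /eqP ev; rewrite -ev de in dv.
have ev : e != v by apply: contraNneq dv => <-; rewrite de.
have ew : e != w by apply: contraNneq dw => <-; rewrite de.
rewrite inE mem_rcons inE (negbTE ev) (negbTE ew) /= => em.
case/splitPr: em s U P dm => m1 m2 s U P dm.
have [v' Ev] : exists v', v = i v'.
  by case: (blowup_along_cases v bl) => // ve; rewrite ve eqxx in ev.
have [w' Ew] : exists w', w = i w'.
  by case: (blowup_along_cases w bl) => // we'; rewrite we' eqxx in ew.
rewrite s in U; move: (U); rewrite -rcons_cons rcons_uniq -cat_cons cat_uniq.
rewrite [uniq (e :: m2)]cons_uniq [has _ _]/= [e \in v :: m1]inE.
case/and4P=> _ _ + /andP[em2 _]; rewrite !negb_or => /andP[/andP[_ em1] _].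
have [m1' E1] := seq_preimage bl em1; have [m2' E2] := seq_preimage bl em2.
have [y [r Er]] : exists y r, rcons m2' w' = y :: r.
  by case: (m2') => [|y r]; eexists _, _.
have Es : pseq g1 = map i (v' :: m1') ++ e :: map i (y :: r).
  by rewrite s Ev Ew E1 E2 -Er map_rcons rcons_cat.
pose x := last v' m1'.
have [xA yA] : x \in A /\ y \in A.
  move: P; rewrite rcons_cat rcons_cons Ev Ew E1 E2 -map_rcons Er cat_path /=.
  by rewrite last_map -/x adjC !ae => /and4P[_ -> ->].
have xl : v' :: m1' = rcons (belast v' m1') x by rewrite lastI.
have Um : uniq (map i ((v' :: m1') ++ (y :: r))).
  apply: subseq_uniq U; rewrite -s Es map_cat; apply: cat_subseq => //.
  exact: subseq_cons.
rewrite (map_inj_uniq iI) in Um.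
have xy : x != y.
  apply: contraTneq Um => <-; rewrite cat_uniq; apply/negP=> /and3P[_ + _].
  by rewrite /= xl mem_rcons mem_head.
have EA : A = [set x; y].
  have [y0 [EA _ _]] := clique2P A2 cA xA; move: yA.
  by rewrite EA !inE eq_sym (negbTE xy) /= => /eqP->.
have axy : adj x y by apply: cA.
have notA z : z != x -> z != y -> z \notin A.
  by move=> zx zy; rewrite EA !inE negb_or zx zy.
have [P1 P2] : path (relpre i (@adj F)) v' m1' /\ path (relpre i (@adj F)) y r.
  move: P; rewrite rcons_cat rcons_cons Ev Ew E1 E2 -map_rcons Er cat_path /= !path_map.
  by case/and4P.
have Es' : v' :: rcons (m1' ++ m2') w' = (v' :: m1') ++ y :: r.
  by rewrite rcons_cat Er.
have [|g sg] := @epath_of_spec G ((v' :: m1') ++ y :: r).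
  rewrite -Es'; apply: (EpathLong (erefl _)).
  - by rewrite Es'.
  - rewrite rcons_cat Er cat_path /= -/x axy; apply/andP; split.
      by apply: sub_path P1 => a b; rewrite /= ai => /andP[].
    by apply: sub_path P2 => a b; rewrite /= ai => /andP[].
  - by rewrite -di -Ev.
  - by rewrite -di -Ew.
  - move: dm; rewrite E1 E2 !all_cat /= !all_map => /and3P[d1 _ d2].
    by apply/andP; split; [apply: sub_all d1|apply: sub_all d2] => a; rewrite /deg2 /= di.
exists g; split.
  rewrite /lies_over sg Es map_cat filter_cat (filter_exceptional _ bl); congr (_ ++ _).
  by rewrite -[LHS](filter_exceptional (y :: r) bl) /= eqxx.
apply: seq_equiv_sym; apply: rst_step; apply/seq_blowupP.
rewrite /Wt -!/(weights _) sg Es.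
exists (weights (map i (v' :: m1'))), (weights (map i (y :: r))); split.
  by rewrite weights_cat /weights /= de /= we.
have Um' := Um; rewrite cat_uniq in Um'; case/and3P: Um' => U1 /hasPn disj U2.
have xl' : {in belast v' m1', forall z, z != x /\ z \in v' :: m1'}.
  move=> z zb; split; last by rewrite xl mem_rcons inE zb orbT.
  by move: U1; rewrite xl rcons_uniq => /andP[+ _]; apply: contraNneq => <-.
rewrite weights_cat (weights_map_cons bl) //; first last.
- case: (m2') E2 Er => [|z t] E2' /= [yE rE]; first by rewrite -rE orbT.
  suff : deg2 (i y) by rewrite /deg2 di => /eqP->.
  by apply: (allP dm); rewrite E2' -yE mem_cat !inE eqxx !orbT.
- move=> z zr; apply: notA.
    apply: contraTneq zr => ->; apply/negP=> xr.
    have := disj x; rewrite inE xr orbT => /(_ isT)/negP[].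
    by rewrite /= xl mem_rcons mem_head.
  by apply: contraTneq zr => ->; case/andP: U2.
rewrite xl (weights_map_rcons bl) //.
- move=> z /xl'[zx zm]; apply: notA => //.
  have := disj y (mem_head _ _); apply: contraNneq => <-; exact: zm.
- rewrite /x; case/lastP: (m1') E1 => [|t z] E1'; first by rewrite eqxx orbT.
  suff : deg2 (i z) by rewrite last_rcons /deg2 di => /eqP->.
  by apply: (allP dm); rewrite E1' mem_cat map_rcons mem_rcons mem_head.
Qed.

(** The path starts with e and a.  It shrinks to the single vertex a when a is isolated in
    G, in which case a is the other end of the path. *)
Lemma epath_down_leaf (G F : wgraph) (a : G) (e : F) (i : G -> F) (g1 : epath F) :
  blowup_along [set a] e i -> deg a <= 1 -> val (src g1) = e ->
  exists g, lies_over e i g1 g /\ seq_equiv (Wt g1) (Wt g).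
Proof.
move=> bl da se; have [[iI ine] [we wi] ae ai] := bl.
have de : deg e = 1 by rewrite (deg_exceptional bl) cards1.
have dia := deg_blowup_vertex bl.
case: (epathP g1) => [v s dv|v m w s U P dv dw dm].
  by move: se; rewrite (src_pseq s) => ve; rewrite ve de in dv.
move: se; rewrite (src_pseq s) => ve; subst v.
rewrite s in U; case/andP: (U) => eU _.
have [l El] := seq_preimage bl eU.
case: l El => [|b t] El; first by case: (m) El.
have ba : b = a.
  by move: P; rewrite El /= ae => /andP[/set1P].
rewrite {b}ba in El.
have aNt : a \notin t.
  move: U; rewrite El => /= /and3P[_ + _].
  by apply: contra => at_; rewrite map_f.
have dt : {in t, forall x, deg (i x) = deg x}.
  move=> x xt; apply: (deg_blowup_notin bl); rewrite inE.
  by apply: contraNneq aNt => <-.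
have [|g sg] := @epath_of_spec G (a :: t).
  case/lastP: t El aNt dt => [|t y] El aNt dt.
    case: m {s U P dm eU} El => [[wa]|z m [_]]; last by case: m.
    apply: (EpathPoint (erefl _)); move: dw; rewrite wa dia eqSS => d1.
    by case: (deg a) da d1 => [|[]].
  case: m El s U P dm eU dw => [[_]|z m]; first by case: t aNt dt.
  rewrite map_cons map_rcons rcons_cons => -[-> /rcons_inj[-> ->]] s U P dm eU dw.
  apply: (EpathLong (erefl _)).
  - move: U => /= /and3P[_ _]; rewrite -map_rcons (map_inj_uniq iI) => ->.
    by rewrite aNt.
  - move: P => /= /andP[_]; rewrite -map_rcons path_map.
    by apply: sub_path => x z' /=; rewrite ai => /andP[].
  - by move: dm => /= /andP[]; rewrite /deg2 dia eqSS => /eqP->.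
  - by rewrite -dt // mem_rcons mem_head.
  - apply/allP => x xt; move: dm => /= /andP[_]; rewrite all_map => /allP/(_ x xt).
    by rewrite /deg2 /= dt // mem_rcons inE xt orbT.
exists g; rewrite /lies_over /Wt -!/(weights _) s El sg; split.
  by rewrite -[LHS](filter_exceptional (a :: t) bl) /= eqxx.
have wtt : weights (map i t) = weights t.
  apply: (weights_map bl dt) => x xt _; rewrite inE.
  by apply: contraNneq aNt => <-.
have -> : weights (e :: map i (a :: t)) = [:: -1, wt a - 1 & weights t]%R.
  by rewrite -wtt /weights /= de dia /= !ltnS da /= wi inE eqxx we.
have -> : weights (a :: t) = wt a :: weights t.
  by rewrite /weights /= (leq_ltn_trans da).
by apply/seq_equiv_sym/rst_step/SeqBlowupLeft.
Qed.

Lemma epath_down (G F : wgraph) (A : {set G}) (e : F) (i : G -> F) (g1 : epath F) :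
  strict_along A e i ->
  exists g, lies_over e i g1 g /\ seq_equiv (Wt g1) (Wt g).
Proof.
move=> st; have [eg1|] := boolP (e \in pseq g1); last exact: (epath_down_avoid st).
case: (st) => bl [[A2 cA]|[a [EA da]]]; first exact: epath_down_edge bl A2 cA eg1.
rewrite {}EA in st bl; have de : deg e = 1 by rewrite (deg_exceptional bl) cards1.
have [se|te] : val (src g1) = e \/ val (tgt g1) = e.
  case: (epathP g1) eg1 => [v s _|v m w s U _ _ _ dm].
    by rewrite (src_pseq s) s inE => /eqP; left.
  rewrite (src_pseq s) (tgt_pseq s) last_rcons s inE mem_rcons inE.
  case/or3P=> [/eqP|/eqP|em]; [by left|by right|].
  by have := allP dm e em; rewrite /deg2 de.
- exact: epath_down_leaf bl da se.
- have [|g [lg wg]] := @epath_down_leaf _ _ a e i (rev_epath g1) bl da.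
    by rewrite src_rev.
  exists (rev_epath g); split; first by have := lies_over_rev lg; rewrite rev_epathK.
  by have := seq_equiv_rev wg; rewrite !Wt_rev revK.
Qed.

Lemma blowdown_map_exists (G F : wgraph) (A : {set G}) (e : F) (i : G -> F) :
  strict_along A e i -> exists f : core F -> core G, is_blowdown_map e i f.
Proof.
case=> bl st; have [[iI ine] _ ae ai] := bl.
have H (x : core F) : exists y : core G, ((val x == e) ==> adj e (i (val y))) &&
    ((val x != e) ==> (i (val y) == val x)).
  have [xe|[y Ey]] := blowup_along_cases (val x) bl.
    case: st => [[A2 _]|[a [EA da]]].
      by have := valP x; rewrite /= xe (deg_exceptional bl) A2.
    have ca : deg a != 2 by rewrite ltn_eqF.
    by exists (exist _ a ca); rewrite xe eqxx /= ae EA inE eqxx.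
  have cy : deg y != 2.
    have := valP x; rewrite /= Ey.
    case: st => [[A2 cA]|[a [EA da]]]; first by rewrite (deg_blowup_edge y bl cA A2).
    have [->|ya] := eqVneq y a; first by move=> _; rewrite ltn_eqF.
    by rewrite (deg_blowup_notin bl) // EA inE.
  exists (exist _ y cy); rewrite Ey eqxx /= implybT andbT.
  have ye : i y != e by apply/ine; exists y.
  by rewrite (negbTE ye).
exists (fun x => xchoose (H x)) => x.
have /andP[/implyP H1 /implyP H2] := xchooseP (H x); split=> [/eqP//|/eqP xe].
exact/eqP/H2.
Qed.

Lemma lies_over_src (G F : wgraph) (A : {set G}) (e : F) (i : G -> F)
    (f : core F -> core G) g1 g :
  strict_along A e i -> is_blowdown_map e i f -> lies_over e i g1 g ->
  src g = f (src g1).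
Proof.
case=> bl st fP; have [[iI ine] _ ae ai] := bl => over; apply: val_inj.
have [q Eq] := pseq_cons g; have [p Ep] := pseq_cons g1.
have [f1 f2] := fP (src g1).
move: over; rewrite /lies_over Eq Ep /=.
have [se|se] := eqVneq (sval (src g1)) e; last first.
  by case=> E _; apply: iI; rewrite f2 //; apply/eqP.
have de : deg e != 2 by rewrite -se (valP (src g1)).
case: st => [[A2 _]|[a [EA da]]]; first by rewrite (deg_exceptional bl) A2 in de.
have fa : val (f (src g1)) = a by move: (f1 se); rewrite ae EA => /set1P.
rewrite fa; case: p Ep => [|z p] // Ep.
have ez : adj e z by move: (epath_straight Ep); rewrite -se; case/and4P=> _ /andP[].
have ze : z != e by rewrite eq_sym adj_neq.
rewrite /= ze => -[E _]; move: ez; rewrite -E ae EA => /set1P.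
by [].
Qed.

Lemma lies_over_tgt (G F : wgraph) (A : {set G}) (e : F) (i : G -> F)
    (f : core F -> core G) g1 g :
  strict_along A e i -> is_blowdown_map e i f -> lies_over e i g1 g ->
  tgt g = f (tgt g1).
Proof.
move=> st fP /lies_over_rev over.
by rewrite -src_rev (lies_over_src st fP over) src_rev.
Qed.

(** A suitable path of F is started along the edge over the first edge of g; its image in G
    is determined by its first two vertices, so it is g. *)
Lemma epath_up (G F : wgraph) (A : {set G}) (e : F) (i : G -> F) (g : epath G) :
  forest F -> strict_along A e i -> exists g1, lies_over e i g1 g.
Proof.
move=> forF st; case: (st) => bl sst; have [[iI ine] _ ae ai] := bl.
have ie y : (i y == e) = false by apply/negbTE/ine; exists y.
have de := deg_exceptional bl.
have point a g1 p : pseq g = [:: a] -> deg a = 0 ->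
    [seq z <- pseq g1 | z != e] = i a :: p -> exists g1, lies_over e i g1 g.
  move=> Eg d0 E1; have [g' [over _]] := epath_down g1 st.
  exists g1; suff -> : g = g' by [].
  apply: pseq_inj; have [q Eq] := pseq_cons g'.
  have sa : val (src g') = a by move: over; rewrite /lies_over Eq E1 => -[/iI].
  by rewrite Eg (src_deg0_tgt (_ : deg (val (src g')) = 0)) sa.
have long a x q g1 p : pseq g = [:: a, x & q] ->
    [seq z <- pseq g1 | z != e] = [:: i a, i x & p] -> exists g1, lies_over e i g1 g.
  move=> Eg E1; have [g' [over _]] := epath_down g1 st.
  exists g1; suff -> : g = g' by [].
  move: over; rewrite /lies_over E1; case Eq: (pseq g') => [|a' [|x' q']] //=.
  by case=> /iI aa /iI xx _; rewrite aa xx in Eq; apply: epath_det Eg Eq.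
have [q Eg] := pseq_cons g; set a := val (src g) in Eg.
case: q Eg => [|x q] Eg.
  have d0 : deg a = 0.
    by apply: src_tgt_deg0; apply: val_inj; rewrite (tgt_pseq Eg).
  have [aA|aA] := boolP (a \in A); last first.
    have d1 : deg (i a) = 0 by rewrite (deg_blowup_notin bl aA).
    have [g1 E1] := epath_of_spec (EpathPoint (erefl [:: i a]) d1).
    by apply: (@point a g1 [::]); rewrite // E1 /= ie.
  have eia : adj e (i a) by rewrite ae.
  have de2 : deg e != 2.
    case: sst => [[A2 cA]|[b [EA _]]]; last by rewrite de EA cards1.
    have [y [_ _ ay]] := clique2P A2 cA aA.
    by have : 0 < deg a; [apply/deg_gt0P; exists y|rewrite d0].
  have [g1 [p E1]] := edge_epath forF de2 eia.
  by apply: (@point a g1 [seq z <- p | z != e]); rewrite // E1 /= eqxx ie.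
have sg := epath_straight Eg.
have ax : adj a x by case/and4P: sg => _ /andP[].
have ca : deg a != 2 := valP (src g).
(* A leaf a that is blown up is no longer an end in F: the path starts at e instead. *)
have [A1|A1] := eqVneq A [set a].
  have da : deg a = 1.
    apply/eqP; rewrite eqn_leq; apply/andP; split; last by apply/deg_gt0P; exists x.
    case: sst => [[A2 _]|[b [EA db]]]; first by rewrite A1 cards1 in A2.
    by move: A1; rewrite EA => /set1_inj <-.
  have de2 : deg e != 2 by rewrite de A1 cards1.
  have eia : adj e (i a) by rewrite ae A1 inE.
  have [g1 [p E1]] := edge_epath forF de2 eia.
  have s1 := epath_straight E1; case: p E1 s1 => [|z p] E1 s1.
    by case/and4P: s1 => _ _ _ /=; rewrite /deg2 A1 in bl *; rewrite (deg_blowup_vertex bl) da.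
  case/and4P: s1 => [+ /and3P[_ az _] _ _].
  rewrite /= !inE !negb_or => /andP[/and3P[_ ez _] _].
  have [ze|[y Ey]] := blowup_along_cases z bl; first by rewrite ze eqxx in ez.
  apply: (@long a x q g1 [seq z <- p | z != e]) => //.
  rewrite E1 /= eqxx ie eq_sym ez Ey; congr [:: _, i _ & _].
  apply: contra_eq (da) => yx; rewrite neq_ltn; apply/orP; right.
  apply/deg_gt1P; exists x, y; rewrite ax eq_sym; split=> //.
  by move: az; rewrite Ey ai => /andP[].
have cia : deg (i a) != 2.
  have [aA|aA] := boolP (a \in A); last by rewrite (deg_blowup_notin bl aA).
  case: sst => [[A2 cA]|[b [EA db]]]; first by rewrite (deg_blowup_edge a bl cA A2).
  by move: aA A1; rewrite EA => /set1P->; rewrite eqxx.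
(* If the first edge of g is the one that is subdivided, the path in F starts with i a, e. *)
have [/andP[aA xA]|nax] := boolP ((a \in A) && (x \in A)); last first.
  have iax : adj (i a) (i x) by rewrite ai ax.
  have [g1 [p E1]] := edge_epath forF cia iax.
  by apply: (@long a x q g1 [seq z <- p | z != e]); rewrite // E1 /= !ie.
have A2 : #|A| = 2.
  case: sst => [[//]|[b [EA db]]].
  by move: aA A1; rewrite EA => /set1P->; rewrite eqxx.
have iae : adj (i a) e by rewrite adjC ae.
have [g1 [p E1]] := edge_epath forF cia iae.
have s1 := epath_straight E1; case: p E1 s1 => [|z p] E1 s1.
  by case/and4P: s1 => _ _ _ /=; rewrite /deg2 de A2.
case/and4P: s1 => [+ /and3P[_ ez _] _ _].
rewrite /= !inE !negb_or => /andP[/and3P[_ az _] _].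
have ze : z != e by rewrite eq_sym adj_neq.
have [/eqP|[y Ey]] := blowup_along_cases z bl; first by rewrite (negbTE ze).
apply: (@long a x q g1 [seq z <- p | z != e]) => //.
rewrite E1 /= eqxx ie ze Ey; congr [:: _, i _ & _].
have yA : y \in A by rewrite -ae -Ey.
case: sst => [[_ cA]|[b [EA _]]]; last by rewrite EA cards1 in A2.
have [t [EA _ _]] := clique2P A2 cA aA.
have ya : y != a by apply: contraNneq az => <-; rewrite Ey.
have xa : x != a by rewrite eq_sym adj_neq.
move: xA yA; rewrite EA !inE (negbTE xa) (negbTE ya) /= => /eqP-> /eqP->.
by [].
Qed.

(** * Pseudo-minimality *)

Definition weight_compatible (F G : wgraph) (f : skelmap F G) : Prop :=
  (forall g, seq_equiv (Wt g) (Wt (svec f g))) /\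
  (forall x, (2 < deg (val x)) = (2 < deg (val (f x)))).

Lemma pseudo_minimal_compatible (F G : wgraph) (f : skelmap F G) :
  forest F -> forest G -> weight_compatible f ->
  pseudo_minimal F <-> pseudo_minimal G.
Proof.
move=> forF forG [fW fd].
have fpp g : type_pp g <-> type_pp (svec f g).
  by rewrite /type_pp src_svec tgt_svec -!fd.
split=> -[_ H]; split=> // g gW.
  have [g1 E] := sk_surj f g; rewrite -[vec _ _]/(svec f g1) in E.
  by rewrite -E; apply/fpp/H; apply: rst_trans (fW g1) _; rewrite E.
by apply/fpp/H; apply: rst_trans (seq_equiv_sym (fW g)) gW.
Qed.

Lemma strict_blowup_blowup (G F : wgraph) : strict_blowup G F -> blowup G F.
Proof.
case=> e [i [A [bl st]]]; exists A, e, i; split=> //.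
by case: st => [?|[v [? _]]]; [apply: Or32|apply: Or31; exists v].
Qed.

(** The fibre over an isolated vertex a that is blown up consists of e and a, joined by the
    path (e, a); all other fibres are singletons. *)
Lemma blowdown_skelmap (G F : wgraph) (e : F) (i : G -> F) :
  strict_blowup_at e i -> forest G -> forest F ->
  exists f : skelmap F G, is_blowdown_map e i f /\ weight_compatible f.
Proof.
move=> /strict_blowup_along[A st] forG forF; have [f fP] := blowdown_map_exists st.
have [bl sst] := st; have [[iI ine] _ ae ai] := bl.
have de := deg_exceptional bl.
have leaf (x : core F) : val x = e -> exists a, [/\ A = [set a], deg a <= 1 & val (f x) = a].
  move=> xe; case: sst => [[A2 _]|[a [EA da]]].
    by have := valP x; rewrite /= xe de A2.
  by exists a; split=> //; move: ((fP x).1 xe); rewrite ae EA => /set1P.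
have down g1 : exists g, [/\ src g = f (src g1), tgt g = f (tgt g1)
    & seq_equiv (Wt g1) (Wt g)].
  have [g [over gW]] := epath_down g1 st.
  by exists g; rewrite (lies_over_src st fP over) (lies_over_tgt st fP over).
have join (x y : core F) : val x = e -> x != y -> f x = f y ->
    exists g, src g = x /\ tgt g = y.
  move=> xe xy fxy; have [a [EA da fxa]] := leaf x xe.
  have ye : val y <> e by rewrite -xe => /val_inj yx; rewrite yx eqxx in xy.
  have Ey : i a = val y by rewrite -fxa fxy (fP y).2.
  have eia : adj e (i a) by rewrite ae EA inE.
  have [|g Eg] := @epath_of_spec F (e :: rcons [::] (i a)).
    apply: (EpathLong (erefl _)) => //=.
    - by rewrite inE andbT adj_neq.
    - by rewrite eia.
    - by rewrite -xe (valP x).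
    - by rewrite Ey (valP y).
  exists g; split; apply: val_inj; first by rewrite (src_pseq Eg) xe.
  by rewrite (tgt_pseq Eg).
have [g|g|x y xy fxy|s sf] := @skelmap_exists F G f forG.
- by have [g' [? ? _]] := down g; exists g'.
- have [g1 over] := epath_up g forF st.
  by exists g1; rewrite (lies_over_src st fP over) (lies_over_tgt st fP over).
- have [xe|xe] := eqVneq (val x) e; first exact: join.
  have [ye|ye] := eqVneq (val y) e.
    have [g [sg tg]] := join y x ye (etrans (congr1 negb (eq_sym _ _)) xy) (esym fxy).
    by exists (rev_epath g); rewrite src_rev tgt_rev.
  move/eqP: xy; case; apply: val_inj.
  by rewrite -((fP x).2 (elimN eqP xe)) -((fP y).2 (elimN eqP ye)) fxy.
exists s; split; first by move=> x; rewrite sf; apply: fP.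
split=> [g|x].
  have [g' [sg tg gW]] := down g.
  by rewrite (@svec_unique _ _ s g g') // ?sf.
rewrite sf; have [xe|xe] := eqVneq (val x) e.
  have [a [EA da ->]] := leaf x xe; rewrite xe de EA cards1.
  by case: (deg a) da => [|[|]].
rewrite -((fP x).2 (elimN eqP xe)); set y := val (f x).
case: sst => [[A2 cA]|[a [EA da]]]; first by rewrite (deg_blowup_edge y bl cA A2).
have [ya|ya] := eqVneq y a; last by rewrite (deg_blowup_notin bl) // EA inE.
rewrite ya; rewrite EA in bl; rewrite (deg_blowup_vertex bl).
by rewrite !ltnS !ltnNge da (leq_trans da).
Qed.

Lemma iso_skelmap (G H : wgraph) (phi : G -> H) : forest H -> bijective phi ->
  (forall x y, adj (phi x) (phi y) = adj x y) ->
  (forall x, wt (phi x) = wt x) ->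
  exists f : skelmap G H, (forall x, val (f x) = phi (val x)) /\ weight_compatible f.
Proof.
move=> forH bphi a w; have dphi := deg_iso bphi a.
have phiI := bij_inj bphi; case: bphi => psi K K'.
have cphi (x : core G) : deg (phi (val x)) != 2 by rewrite dphi (valP x).
have lift g : exists g' : epath H, pseq g' = map phi (pseq g).
  apply: epath_of_spec; apply: (@epath_spec_map _ _ psi); first exact: can_inj K'.
  - by move=> x _; rewrite -[in RHS](K' x) dphi.
  - by move=> x y; rewrite -a !K'.
  - by rewrite mapK //; apply: epathP.
pose f x : core H := exist _ (phi (val x)) (cphi x).
have ends g g' : pseq g' = map phi (pseq g) -> src g' = f (src g) /\ tgt g' = f (tgt g).
  have [p Ep] := pseq_cons g; rewrite Ep => E; split; apply: val_inj.
    by rewrite (src_pseq E).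
  by rewrite (tgt_pseq E) last_map -(tgt_pseq Ep).
have fI : injective f by move=> x y /(congr1 val)/phiI/val_inj.
have [g|g'|x y xy /fI yx|s sf] := @skelmap_exists G H f forH.
- by have [g' /ends] := lift g; exists g'.
- have [|g E] := @epath_of_spec G (map psi (pseq g')).
    apply: (epath_spec_map phiI) => [x _|x y|]; rewrite ?dphi ?a //.
    by rewrite mapK //; apply: epathP.
  by exists g; apply: ends; rewrite E mapK.
- by rewrite yx eqxx in xy.
exists s; split; first by move=> x; rewrite sf.
split=> [g|x]; last by rewrite sf dphi.
have [g' E] := lift g; have [sg tg] := ends _ _ E.
rewrite (@svec_unique _ _ s g g') ?sf //.
suff -> : Wt g' = Wt g by apply: rst_refl.
rewrite /Wt E filter_map -map_comp.
rewrite (eq_filter (a2 := fun v => deg v < 3)); last by move=> x /=; rewrite dphi.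
by apply: eq_map => x /=.
Qed.

(** A path whose weight sequence is equivalent to the empty one records no weight at all, so
    its ends have degree at least 3. *)
Lemma minimal_pseudo_minimal (G : wgraph) :
  forest G -> minimal_graph G -> pseudo_minimal G.
Proof.
move=> forG minG; split=> // g gW.
have W0 : Wt g = [::].
  apply: minimal_seq_equiv_nil gW; apply/negP => /mapP[v].
  by rewrite mem_filter => /andP[dv _] wv; apply: (minG v); apply: forest_contractible.
have high v : v \in pseq g -> 2 < deg v.
  move=> vg; rewrite ltnNge -ltnS; apply/negP => dv.
  have : wt v \in Wt g by apply/map_f; rewrite mem_filter dv.
  by rewrite W0.
split; apply: high; first by have [p ->] := pseq_cons g; rewrite mem_head.
have [p E] := pseq_cons g; rewrite (tgt_pseq E) E; exact: mem_last.
Qed.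

(** * Equivalence of pairs *)

Definition add_isolated_adj (G : wgraph) : rel (option G) :=
  fun x y => if (x, y) is (Some x', Some y') then adj x' y' else false.

Lemma add_isolated_sym (G : wgraph) : symmetric (@add_isolated_adj G).
Proof. by case=> [x|] [y|] //=; apply: adj_sym. Qed.

Lemma add_isolated_irr (G : wgraph) : irreflexive (@add_isolated_adj G).
Proof. by case=> [x|] //=; apply: adj_irr. Qed.

Definition add_isolated (G : wgraph) : wgraph :=
  @WGraph (Graph (@add_isolated_sym G) (@add_isolated_irr G))
    (fun x => if x is Some x' then wt x' else (-1)%R).

(** The free blowing-up of H is also one of G. *)
Lemma wiso_wequiv (G H : wgraph) : wiso G H -> wequiv G H.
Proof.
have free_blowup K : wiso K H -> blowup K (add_isolated H).
  case=> phi [[psi Kp Kp'] a w]; exists set0, None, (fun x => Some (phi x)).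
  split; last by apply: Or33.
  split.
  - split=> [x y [/(can_inj Kp)]//|[x|]]; split=> //; last by case.
    by exists (psi x); rewrite Kp'.
  - by split=> // x; rewrite inE /= w.
  - by move=> x; rewrite inE.
  - by move=> x y; rewrite inE andbT -a.
move=> GH; apply: (@rst_trans _ _ _ (add_isolated H)).
  exact/rst_step/free_blowup.
exact/rst_sym/rst_step/free_blowup/wiso_refl.
Qed.

Lemma FO_equiv_wequiv (S : graph) (q q' : skpair S) :
  FO_equiv q q' -> wequiv (p2 q) (p2 q').
Proof.
elim=> {q q'} [q q' [_ _ H]|q|q q' _|q q' q'' _ + _].
- case: H => [[e [i [_ [st _ _]]]]|[phi [b a w _]]].
    by apply/rst_sym/rst_step/strict_blowup_blowup; exists e, i.
  by apply: wiso_wequiv; exists phi.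
- exact: rst_refl.
- exact: rst_sym.
- exact: rst_trans.
Qed.

(** A strict blowing-down is followed by composing with the blowing-down map, a strict
    blowing-up by lifting along it.  Each step stays among the pseudo-minimal forests by
    [pseudo_minimal_compatible]. *)
Lemma strict_equiv_FO_equiv (S : graph) (G H : wgraph) (s : skelmap S G) :
  skeleton S -> strict_equiv G H -> pseudo_minimal G ->
  exists s' : skelmap S H, FO_class (SkPair s) (SkPair s').
Proof.
case=> forS dS GH.
suff [H1 _] : (forall s : skelmap S G, pseudo_minimal G ->
      exists s' : skelmap S H, FO_class (SkPair s) (SkPair s')) /\
    (forall s : skelmap S H, pseudo_minimal H ->
      exists s' : skelmap S G, FO_class (SkPair s) (SkPair s')) by apply: H1.
have step (q q' : skpair S) : FOplus q -> FOplus q' -> FO_blowdown q q' \/ FO_iso q q' ->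
    FO_class q q' /\ FO_class q' q.
  move=> pq pq' qq'; split; split=> //; last apply: rst_sym; by apply: rst_step.
have iso_step (A B : wgraph) (t : skelmap S A) : wiso A B -> pseudo_minimal A ->
    exists t' : skelmap S B, FO_class (SkPair t) (SkPair t').
  move=> AB pA; have forB := forest_iso AB pA.1; case: AB => phi [b a w].
  have [f [fphi fW]] := iso_skelmap forB b a w.
  have [t' t'E] := skelmap_comp t f forB; exists t'.
  have pB : pseudo_minimal B by apply/(pseudo_minimal_compatible pA.1 forB fW).
  apply: (proj1 (step (SkPair t) (SkPair t') pA pB _)).
  by right; exists phi; split=> // x /=; rewrite t'E fphi.
elim: GH {s} => {G H} [G F [GF|GF]|G|G H _ [? ?]|G K H _ [H1 H2] _ [H3 H4]].
- have forGF := forest_blowup (strict_blowup_blowup GF); case: GF => e [i st].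
  split=> s ps.
    have forG := ps.1; have forF := forGF.1 forG.
    have [f [fP fW]] := blowdown_skelmap st forG forF.
    have [s' s'E] := skelmap_lift f s forS (fun v => (dS v).1) forF forG.
    have pF : pseudo_minimal F by apply/(pseudo_minimal_compatible forF forG fW).
    exists s'; apply: (proj2 (step (SkPair s') (SkPair s) pF ps _)).
    by left; exists e, i, f.
  have forF := ps.1; have forG := forGF.2 forF.
  have [f [fP fW]] := blowdown_skelmap st forG forF.
  have [s' s'E] := skelmap_comp s f forG.
  have pG : pseudo_minimal G by apply/(pseudo_minimal_compatible forF forG fW).
  exists s'; apply: (proj1 (step (SkPair s) (SkPair s') ps pG _)).
  by left; exists e, i, f; split=> // x; rewrite s'E.
- by split=> s; apply: iso_step => //; apply: wiso_sym.
- by split=> s ps; exists s; split=> //; apply: rst_refl.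
- by split.
- split=> s ps.
    have [s1 [p1 e1]] := H1 s ps; have [s2 [p2 e2]] := H3 s1 p1.
    by exists s2; split=> //; apply: rst_trans e1 e2.
  have [s1 [p1 e1]] := H4 s ps; have [s2 [p2 e2]] := H2 s1 p1.
  by exists s2; split=> //; apply: rst_trans e1 e2.
Qed.

Theorem proposition9p2p1 (C : wgraph -> Prop) (hC : equiv_class_of_forests C)
    (G : wgraph) (hG : minimal_elements C G)
    (S : graph) (hS : skeleton S) (sigma : skelmap S G)
    (omega : (epath S -> seq int) -> Prop) (homega : is_Omega omega) :
  let Cplus := FO_class (SkPair sigma) in
  forall hCplus : forall q, Cplus q -> FOplus_omega omega q,
  let Mplus := fun q => Cplus q /\ min_omega omega (pair_edge_map q) in
  forall H : wgraph,
    minimal_elements C H <-> exists2 q : skpair S, Mplus q & p2 q = H.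
Proof.
move=> Cplus hCplus Mplus H.
have [F [forF CF]] := hC; have [CG minG] := hG.
have FG : wequiv F G by apply/CF.
have forG : forest G by apply/(wequiv_forest FG).
split=> [[CH minH]|[q [[pq Gq] [_ minW]] <-]].
  have FH : wequiv F H by apply/CF.
  have GH : strict_equiv G H.
    apply: minimal_wequiv_strict_equiv => //.
    exact: rst_trans (rst_sym _ _ _ _ FG) FH.
  have [s' s'P] := strict_equiv_FO_equiv sigma hS GH (minimal_pseudo_minimal forG minG).
  exists (SkPair s') => //; split=> //; split; first by have [] := hCplus _ s'P.
  move=> g; apply/negP => /mapP[v]; rewrite mem_filter => /andP[dv _] wv.
  by apply: (minH v); apply: forest_contractible => //; apply/(wequiv_forest FH).
split; first by apply/CF; apply: rst_trans FG _; apply: FO_equiv_wequiv Gq.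
move=> v [wv dv _]; have forq : forest (p2 q) := pq.1.
have [g vg] := vertex_on_epath v forq; have [g1 E] := sk_surj (skmap q) g.
have /negP[] := minW g1.
rewrite /pair_edge_map -[svec _ _]/(vec _ _) E -wv.
by apply/map_f; rewrite mem_filter ltnS dv.
Qed.
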